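(* Let a Strassen-like matrix multiplication algorithm with parameters $n_0$ and $p_0$ be given, and let $\omega_0=\log_{n_0} p_0$. Then there exists an algorithm in the $(m,\ell)$-TCU model, with $m\geq n_0$, that multiplies two $\sqrt{n}\times\sqrt{n}$ matrices in time $$T(n)=O\!\left(\left(\frac{n}{m}\right)^{\omega_0}(m+\ell)\right).$$
   Context: The $(m,\ell)$-TCU model (parameters $m\ge 1$, $\ell\ge 0$) is the standard RAM model whose CPU additionally contains a tensor unit: by a constant-size instruction specifying the memory addresses of the operands and of the output, the unit multiplies an $N\times\sqrt{m}$ matrix $A$ by a $\sqrt{m}\times\sqrt{m}$ matrix $B$ (where $N\geq\sqrt{m}$ is a value chosen by the algorithm) and writes $A\cdot B$ to memory, at a cost of $O(N\sqrt{m}+\ell)$ time. The running time of an algorithm is the total cost of all operations performed, including all calls to the tensor unit; the tensor unit, memory and CPU never operate concurrently. Memory words have $\kappa=\Omega(\log(\text{input size}))$ bits. A Strassen-like algorithm with parameters $n_0,p_0$ (with $n_0=O(p_0)$) is a recursive matrix multiplication algorithm built from a base algorithm that multiplies two $\sqrt{n_0}\times\sqrt{n_0}$ matrices using $p_0$ element multiplications and $O(n_0)$ other operations (additions/subtractions): to multiply two $\sqrt{n}\times\sqrt{n}$ matrices with $n>n_0$, it views each as a $\sqrt{n_0}\times\sqrt{n_0}$ matrix whose entries are $\sqrt{n/n_0}\times\sqrt{n/n_0}$ blocks, recursively performs the $p_0$ block multiplications of the base algorithm, and performs $O(n)$ other operations. (E.g., $n_0=4,p_0=8$ gives the standard algorithm,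 $n_0=4,p_0=7$ Strassen's algorithm.)
   Formalization: The formal theorem assumes n ≥ m (for n = 1, ℓ = 0 and m → ∞ the stated bound tends to 0, yet any run takes at least one step) and n_0 > 1 so that log base n_0 is defined; ℓ is a whole number of time steps. *)

(* Defs.v *)
From HB Require Import structures.
From mathcomp Require Export all_boot all_order all_algebra.
From mathcomp Require Export reals exp.
Set Implicit Arguments.
Unset Strict Implicit.
Unset Printing Implicit Defensive.
Import Order.TTheory GRing.Theory Num.Theory.
Local Open Scope ring_scope.

Variant op := Add | Sub | Mul.

Definition is_mul (o : op) : bool := if o is Mul then true else false.

Definition ring_op (S : pzRingType) (o : op) (x y : S) : S :=
  match o with Add => x + y | Sub => x - y | Mul => x * y end.

(* Base algorithms: straight-line programs in the entries of two q x q
   matrices. [Res k] is the result of the k-th operation. *)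

Variant operand (q : nat) :=
  | EntA of 'I_q & 'I_q
  | EntB of 'I_q & 'I_q
  | Res of nat.
Arguments Res {q} _.

Record slp (q : nat) := Slp {
  slp_code : seq (op * operand q * operand q);
  slp_out : 'I_q -> 'I_q -> operand q }.

Definition operand_wf q (k : nat) (x : operand q) : bool :=
  if x is Res i then (i < k)%N else true.

Definition slp_wf q (b : slp q) : Prop :=
  (forall k o x y, onth (slp_code b) k = Some (o, x, y) ->
     operand_wf k x && operand_wf k y) /\
  (forall i j, operand_wf (size (slp_code b)) (slp_out b i j)).

Definition operand_val (S : pzRingType) q (A B : 'M[S]_q) (vs : seq S)
    (x : operand q) : S :=
  match x with EntA i j => A i j | EntB i j => B i j | Res k => vs`_k end.

Definition slp_vals (S : pzRingType) q (b : slp q) (A B : 'M[S]_q) : seq S :=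
  foldl (fun vs ins => let: (o, x, y) := ins in
           rcons vs (ring_op o (operand_val A B vs x) (operand_val A B vs y)))
        [::] (slp_code b).

Definition slp_eval (S : pzRingType) q (b : slp q) (A B : 'M[S]_q) : 'M[S]_q :=
  \matrix_(i, j) operand_val A B (slp_vals b A B) (slp_out b i j).

Definition slp_muls q (b : slp q) : nat :=
  count (fun ins => is_mul ins.1.1) (slp_code b).

Definition slp_others q (b : slp q) : nat :=
  count (fun ins => ~~ is_mul ins.1.1) (slp_code b).

(* The base algorithm b of a Strassen-like algorithm over R with parameters
   n0 = s0 ^ 2 and p0. It has to multiply s0 x s0 matrices whose entries are
   square blocks over R, since the recursive algorithm applies it to such block
   matrices. The constant c is the one hidden in n0 = O(p0) and in the O(n0)
   additions and subtractions. *)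
Definition strassen_like (R : nzRingType) (s0 p0 c : nat) (b : slp s0) : Prop :=
  [/\ slp_wf b,
      slp_muls b = p0,
      (slp_others b <= c * s0 ^ 2)%N,
      (s0 ^ 2 <= c * p0)%N &
      forall (k : nat) (A B : 'M['M[R]_k]_s0), slp_eval b A B = A *m B].

(* The TCU machine. A word holds either a kappa-bit integer or one matrix
   entry, i.e. an element of the coefficient ring R. *)

Variant word (R : Type) := Int of nat | Elt of R.
Arguments Int {R} _.

(* Arguments are register numbers, except the immediate c of [Imm], the
   operation o of [Arith] and the jump targets t. [Tensor] multiplies the
   r_h x s matrix at address r_a by the s x s matrix at address r_b, with
   r_h >= s. *)
Variant instr :=
  | Imm (k c : nat)                (* r_k := c *)
  | Move (k i : nat)               (* r_k := r_i *)
  | Arith (o : op) (k i j : nat)   (* r_k := r_i o r_j *)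
  | Div (k i j : nat)              (* r_k := r_i / r_j, on integers *)
  | Read (k i : nat)               (* r_k := mem[r_i] *)
  | Write (i k : nat)              (* mem[r_i] := r_k *)
  | Jump (t : nat)
  | JumpLt (i j t : nat)           (* if r_i < r_j goto t, on integers *)
  | Tensor (a b c h : nat)         (* writes the product at r_c *)
  | Halt.

Definition program := seq instr.

Record state (R : Type) := State {
  pc : nat;
  regs : nat -> word R;
  mem : nat -> word R }.

Definition upd (T : Type) (f : nat -> T) (x : nat) (v : T) : nat -> T :=
  fun y => if y == x then v else f y.

Definition is_elt (R : Type) (w : word R) : bool :=
  if w is Elt _ then true else false.

Definition elt (R : nzRingType) (w : word R) : R :=
  if w is Elt x then x else 0.

(* Matrices are stored in row-major order from address a on. *)
Definition holds_mx (R : Type) (M : nat -> word R) (a h w : nat) : bool :=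
  [forall i : 'I_h, forall j : 'I_w, is_elt (M (a + i * w + j)%N)].

Definition load_mx (R : nzRingType) (M : nat -> word R) (a h w : nat) :
    'M[R]_(h, w) :=
  \matrix_(i, j) elt (M (a + i * w + j)%N).

Definition store_mx (R : nzRingType) (M : nat -> word R) (a h w : nat)
    (X : 'M[R]_(h, w)) : nat -> word R :=
  fun x => if [pick ij : 'I_h * 'I_w | x == a + ij.1 * w + ij.2]%N is Some ij
           then Elt (X ij.1 ij.2) else M x.

(* Integer arithmetic is modulo 2 ^ kappa; operations on words of different
   kinds are undefined. *)
Definition arith (R : nzRingType) (kappa : nat) (o : op) (x y : word R) :
    option (word R) :=
  match x, y with
  | Int a, Int b =>
      Some (Int (match o with
                 | Add => a + b
                 | Sub => a + (2 ^ kappa - b)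
                 | Mul => a * b
                 end %% 2 ^ kappa)%N)
  | Elt a, Elt b => Some (Elt (ring_op o a b))
  | _, _ => None
  end.

(* One step of the tensor-unit machine with word size kappa, m = s ^ 2 and
   latency l; the second component is the cost of the step. [None] is a
   failure (or a halted machine, see [exec]). *)
Definition step (R : nzRingType) (kappa s l : nat) (P : program)
    (st : state R) : option (state R * nat) :=
  let: State q r M := st in
  match nth Halt P q with
  | Imm k c => Some (State q.+1 (upd r k (Int (c %% 2 ^ kappa)%N)) M, 1%N)
  | Move k i => Some (State q.+1 (upd r k (r i)) M, 1%N)
  | Arith o k i j =>
      if arith kappa o (r i) (r j) is Some w
      then Some (State q.+1 (upd r k w) M, 1%N) else None
  | Div k i j =>
      if (r i, r j) is (Int a, Int b)
      then Some (State q.+1 (upd r k (Int (a %/ b)%N)) M, 1%N) else None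
  | Read k i =>
      if r i is Int a then Some (State q.+1 (upd r k (M a)) M, 1%N) else None
  | Write i k =>
      if r i is Int a then Some (State q.+1 r (upd M a (r k)), 1%N) else None
  | Jump t => Some (State t r M, 1%N)
  | JumpLt i j t =>
      if (r i, r j) is (Int a, Int b)
      then Some (State (if (a < b)%N then t else q.+1) r M, 1%N) else None
  | Tensor ra rb rc rh =>
      if (r ra, r rb, r rc, r rh) is (Int a, Int b, Int c, Int h) then
        if [&& s <= h, a + h * s <= 2 ^ kappa, b + s * s <= 2 ^ kappa,
               c + h * s <= 2 ^ kappa, holds_mx M a h s & holds_mx M b s s]%N
        then Some (State q.+1 r
                     (store_mx M c (load_mx M a h s *m load_mx M b s s)),
                   (h * s + l)%N)
        else None
      else None
  | Halt => None
  end.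

(* [exec kappa s l P st t st']: started in st, P halts in st' after total
   time t. Running past the end of P is halting. *)
Inductive exec (R : nzRingType) (kappa s l : nat) (P : program) :
    state R -> nat -> state R -> Prop :=
  | exec_halt st : nth Halt P (pc st) = Halt -> exec kappa s l P st 0 st
  | exec_step st st' st'' c t :
      step kappa s l P st = Some (st', c) ->
      exec kappa s l P st' t st'' ->
      exec kappa s l P st (c + t) st''.

(* Input convention: r_0 = d and r_1 = s, the matrices A and B are stored at
   addresses 0 and d ^ 2, all other registers and cells are 0. *)
Definition init (R : nzRingType) (s d : nat) (A B : 'M[R]_d) : state R :=
  State 0 (upd (upd (fun=> Int 0) 0 (Int d)) 1 (Int s))
        (store_mx (store_mx (fun=> Int 0) 0 A) (d ^ 2) B).

(* Output convention: the result is stored at address 2 * d ^ 2. *)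
Definition outputs (R : nzRingType) (d : nat) (st : state R) (X : 'M[R]_d) :
    Prop :=
  forall i j : 'I_d, mem st (2 * d ^ 2 + i * d + j)%N = Elt (X i j).

Definition computes_product (R : nzRingType) (kappa s l : nat) (P : program)
    (d : nat) (A B : 'M[R]_d) (t : nat) : Prop :=
  exists st : state R,
    exec kappa s l P (init s A B) t st /\ outputs st (A *m B).

(* Main.v *)
Require Import Defs.
From HB Require Import structures.
From mathcomp Require Import all_boot all_order all_algebra.
From mathcomp Require Import reals exp.
From mathcomp Require boolp.
From mathcomp Require Import zify ring.
Set Implicit Arguments.
Unset Strict Implicit.
Unset Printing Implicit Defensive.
Import Order.TTheory GRing.Theory Num.Theory.
Local Open Scope ring_scope.

(* Evaluating the base algorithm at the 3 x 3 block matrices x E_01 and y E_12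
   turns it into a bilinear algorithm with integer coefficients,
   (X Y)_o = sum_t ga_(o,t) al_t(X) be_t(Y), with p0 products. Over a prime field
   al is injective and cannot be bijective, so p0 > n0; hence the additions of
   the recursion, sum_i p0^i n0^(k-1-i) m <= p0^k m, are dominated by the leaves
   and no logarithm appears.

   Pad the operands to size D = s s0^k with k minimal such that D >= d. The
   bilinear form allows the recursion to be unrolled level by level without a
   stack: k passes replace each matrix of the current array by its p0 encoded
   blocks, p0^k calls of the tensor unit multiply the s x s matrices that remain,
   and k passes decode the products. Minimality of k gives
   p0^k <= p0 (n/m)^omega0. *)

(** * Bilinear algorithms and their rank *)

(** The base program is a black box: it may build products of any degree, and only its values over
    matrix rings are constrained. Strictly triangular 3 x 3 blocks square to a single corner entry,
    so everything but the bilinear part vanishes. Its coefficients are integers because the program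
    has only ring operations and matrix entries at its disposal. As [R] is an arbitrary nonzero
    ring, the rank argument first moves these integer identities to a prime field. The machine
    program has to be fixed before m, l and n. The coefficients are therefore compiled into
    straight-line code of constant length, and only the depth k is found at run time. Each pass
    writes to a fresh slot of p0^k m cells, so an operand or the result occupies k + 1 slots. All
    addresses are then polynomial in n, which lets a word of a constant multiple of log n bits hold
    every integer that occurs. The additions are bounded in telescoping form: j remaining levels
    cost at most a constant times p0^j - n0^j, and p0 > n0 gives the induction room for the next
    level. *)

Lemma sum_flat (V : nmodType) (p q : nat) (f : nat -> V) :
  \sum_(e < p * q) f e = \sum_(a < p) \sum_(b < q) f (a * q + b)%N.
Proof.
elim: p => [|p IH]; first by rewrite mul0n !big_ord0.
rewrite big_ord_recr /= -IH mulSn addnC -!(big_mkord xpredT f).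
rewrite (@big_cat_nat _ _ _ (p * q)) ?leq_addr //=; congr (_ + _).
rewrite -{1}[(p * q)%N]add0n big_addn addKn big_mkord.
by apply: eq_bigr => i _; rewrite addnC.
Qed.

Section Bilinear.
Variable R : nzRingType.

Definition lin (N : nat) (g : nat -> int) (X : nat -> R) : R :=
  \sum_(e < N) X e *~ g e.

(** Strictly upper triangular matrices. A product keeps only a at (0,1) times b at (1,2), placed at
    (0,2), so products of three factors vanish. *)
Definition tri3 (a b c : R) : 'M[R]_3 :=
  a *: delta_mx 0 1 + b *: delta_mx 1 (inord 2) + c *: delta_mx 0 (inord 2).

Lemma tri3E a b c : [/\ tri3 a b c 0 1 = a, tri3 a b c 1 (inord 2) = b &
  tri3 a b c 0 (inord 2) = c].
Proof.
have e2 : (inord 2 : 'I_3) = Ordinal (isT : 2 < 3)%N by apply: val_inj; rewrite /= inordK.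
by split; rewrite /tri3 !mxE e2 /= ?mulr1 ?mulr0 ?addr0 ?add0r.
Qed.

Lemma tri3M a b c a' b' c' :
  tri3 a b c * tri3 a' b' c' = tri3 0 0 (a * b').
Proof.
have e2 : (inord 2 : 'I_3) = Ordinal (isT : 2 < 3)%N by apply: val_inj; rewrite /= inordK.
rewrite /tri3 e2 -[LHS]/(mulmx _ _).
rewrite !mulmxDl !mulmxDr -!scalemxAl.
have E (u v w z : 'I_3) (x : R) :
  delta_mx u v *m (x *: delta_mx w z) = (x *+ (v == w)) *: delta_mx u z :> 'M[R]_3.
  apply/matrixP => i j; rewrite !mxE (bigD1 v) //= big1 ?addr0 => [|k kv]; last first.
    by rewrite !mxE (negPf kv) andbF mul0r.
  by rewrite !mxE eqxx andbT; case: (i == u); case: (v == w); case: (j == z);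
     rewrite ?mul1r ?mul0r ?mulr0.
rewrite !E /= !mulr1n !mulr0n !scale0r !scaler0 !addr0 !add0r ?scale0r ?add0r scalerA.
done.
Qed.

Lemma tri3D a b c a' b' c' :
  tri3 a b c + tri3 a' b' c' = tri3 (a + a') (b + b') (c + c').
Proof. by rewrite /tri3 !scalerDl addrACA; congr (_ + _); rewrite addrACA. Qed.

Lemma tri3N a b c : - tri3 a b c = tri3 (- a) (- b) (- c).
Proof. by rewrite /tri3 !scaleNr !opprD. Qed.

Lemma tri30 : tri3 0 0 0 = 0.
Proof. by rewrite /tri3 !scale0r !addr0. Qed.

Variable q : nat.
Let N := (q * q)%N.

Notation form := ((nat -> int) * (nat -> int) * seq int)%type.

(** The symbolic result of one operation: a linear form in X at (0,1), one in Y at (1,2), and at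
    (0,2) integer coefficients on the list [ps] of products met so far. Coefficients past the end of
    the list count as 0. *)
Definition form_val (ps : seq ((nat -> int) * (nat -> int))) (X Y : nat -> R)
    (f : form) : 'M[R]_3 :=
  tri3 (lin N f.1.1 X) (lin N f.1.2 Y)
    (\sum_(t < size ps)
       (lin N (nth (fun=> 0, fun=> 0) ps t).1 X *
        lin N (nth (fun=> 0, fun=> 0) ps t).2 Y) *~ f.2`_t).

Definition form0 : form := (fun=> 0, fun=> 0, [::]).

Lemma lin0 X : lin N (fun=> 0) X = 0.
Proof. by rewrite /lin big1. Qed.

Lemma linD g h X : lin N g X + lin N h X = lin N (fun e => g e + h e) X.
Proof. by rewrite /lin -big_split; apply: eq_bigr => e _; rewrite /= mulrzDr. Qed.

Lemma linN g X : - lin N g X = lin N (fun e => - g e) X.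
Proof. by rewrite /lin -sumrN; apply: eq_bigr => e _; rewrite /= mulrNz. Qed.

Lemma lin_delta e0 X : (e0 < N)%N -> lin N (fun e => (e == e0)%:R) X = X e0.
Proof.
move=> lt; rewrite /lin (bigD1 (Ordinal lt)) //= eqxx mulr1z big1 ?addr0 //.
by move=> i /eqP ne; case: eqP => // e; case: ne; apply: val_inj.
Qed.

Lemma form_val0 ps X Y : form_val ps X Y form0 = 0.
Proof.
rewrite /form_val /= !lin0 big1 ?tri30 // => i _; by rewrite nth_nil mulr0z.
Qed.

Definition embA (X : nat -> R) : 'M['M[R]_3]_q :=
  \matrix_(i, j) tri3 (X (i * q + j)%N) 0 0.
Definition embB (X : nat -> R) : 'M['M[R]_3]_q :=
  \matrix_(i, j) tri3 0 (X (i * q + j)%N) 0.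

Lemma flat_lt (i j : 'I_q) : (i * q + j < N)%N.
Proof.
by rewrite /N; case: i j => i lti [j ltj] /=; nia.
Qed.

Definition operand_form (sv : seq form) (x : operand q) : form :=
  match x with
  | EntA i j => (fun e => (e == i * q + j)%N%:R, fun=> 0, [::])
  | EntB i j => (fun=> 0, fun e => (e == i * q + j)%N%:R, [::])
  | Res k => nth form0 sv k
  end.

Lemma operand_formE ps sv X Y x :
  operand_val (embA X) (embB Y) [seq form_val ps X Y f | f <- sv] x =
  form_val ps X Y (operand_form sv x).
Proof.
case: x => [i j|i j|k] /=.
- rewrite mxE /form_val /= lin_delta ?flat_lt // lin0 big1 // => t _.
  by rewrite nth_nil mulr0z.
- rewrite mxE /form_val /= lin_delta ?flat_lt // lin0 big1 // => t _.
  by rewrite nth_nil mulr0z.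
- case: (ltnP k (size sv)) => h; first by rewrite (nth_map form0).
  by rewrite !nth_default ?size_map // form_val0.
Qed.

Lemma operand_form_size n sv x : all (fun f : form => size f.2 <= n)%N sv ->
  (size (operand_form sv x).2 <= n)%N.
Proof.
move=> /(all_nthP form0) h; case: x => //= k.
case: (ltnP k (size sv)) => hk; first exact: h.
by rewrite nth_default.
Qed.

(** A product recorded later leaves earlier values alone, because their coefficient lists are too
    short to see it. *)
Lemma form_val_rcons ps p X Y (f : form) : (size f.2 <= size ps)%N ->
  form_val (rcons ps p) X Y f = form_val ps X Y f.
Proof.
move=> h; rewrite /form_val size_rcons big_ord_recr /=; congr tri3.
rewrite [f.2`_(size ps)]nth_default // mulr0z addr0.
by apply: eq_bigr => i _; rewrite nth_rcons ltn_ord.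
Qed.

(* Evaluating the program at the block matrices (x E_01) and (y E_12) kills
   every product except those of a form in x by a form in y. *)
Lemma slp_forms (code : seq (op * operand q * operand q)) :
  exists ps sv, [/\ size ps = count (fun ins => is_mul ins.1.1) code,
    all (fun f : form => size f.2 <= size ps)%N sv &
    forall X Y, foldl (fun vs ins => let: (o, x, y) := ins in
           rcons vs (ring_op o (operand_val (embA X) (embB Y) vs x)
                               (operand_val (embA X) (embB Y) vs y)))
        [::] code = [seq form_val ps X Y f | f <- sv]].
Proof.
elim/last_ind: code => [|code [[o x] y] [ps [sv [hs ha hv]]]].
  by exists [::], [::].
set f := operand_form sv x; set g := operand_form sv y.
have hf : (size f.2 <= size ps)%N by exact: operand_form_size.
have hg : (size g.2 <= size ps)%N by exact: operand_form_size.
have foldE X Y : foldl (fun vs ins => let: (o, x, y) := ins in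
           rcons vs (ring_op o (operand_val (embA X) (embB Y) vs x)
                               (operand_val (embA X) (embB Y) vs y)))
        [::] (rcons code (o, x, y)) =
   rcons [seq form_val ps X Y f | f <- sv]
     (ring_op o (form_val ps X Y f) (form_val ps X Y g)).
  by rewrite foldl_rcons hv !operand_formE.
have cE : count (fun ins : op * operand q * operand q => is_mul ins.1.1)
   (rcons code (o, x, y)) = (size ps + is_mul o)%N.
  by rewrite -cats1 count_cat /= addn0 hs.
rewrite cE; case: o foldE {cE} => foldE.
- exists ps, (rcons sv (fun e => f.1.1 e + g.1.1 e, fun e => f.1.2 e + g.1.2 e,
     [seq f.2`_t + g.2`_t | t <- iota 0 (size ps)])).
  split; rewrite ?addn0 //; first by rewrite all_rcons /= size_map size_iota leqnn.
  move=> X Y; rewrite foldE map_rcons; congr rcons.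
  rewrite /= tri3D /form_val /= !linD -big_split; congr tri3.
  apply: eq_bigr => t _ /=.
  by rewrite (nth_map 0%N) ?size_iota // nth_iota // add0n mulrzDr.
- exists ps, (rcons sv (fun e => f.1.1 e - g.1.1 e, fun e => f.1.2 e - g.1.2 e,
     [seq f.2`_t - g.2`_t | t <- iota 0 (size ps)])).
  split; rewrite ?addn0 //; first by rewrite all_rcons /= size_map size_iota leqnn.
  move=> X Y; rewrite foldE map_rcons; congr rcons.
  rewrite /= tri3N tri3D /form_val /= !linN !linD -sumrN -big_split; congr tri3.
  apply: eq_bigr => t _ /=.
  by rewrite (nth_map 0%N) ?size_iota // nth_iota // add0n mulrzBr.
(* Only a multiplication extends [ps]: the new pair is the X-form of the left factor with the Y-form
   of the right one, and the result is this product with coefficient 1, its linear parts being 0. *)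
- exists (rcons ps (f.1.1, g.1.2)), (rcons sv (fun=> 0, fun=> 0,
     rcons (nseq (size ps) 0) 1)).
  split; rewrite ?size_rcons ?addn1 //.
    rewrite all_rcons /= size_rcons size_nseq leqnn /=.
    by apply: sub_all ha => h /leqW.
  move=> X Y; rewrite foldE map_rcons; congr rcons.
    by elim: (sv) ha => //= h sv' IH /andP[hh /IH ->]; rewrite form_val_rcons.
  rewrite /= tri3M /form_val /= !lin0 size_rcons big_ord_recr /=; congr tri3.
  rewrite big1 ?add0r => [|t _]; last first.
    by rewrite [X in _ *~ X]nth_rcons size_nseq ltn_ord nth_nseq ltn_ord mulr0z.
  by rewrite !nth_rcons size_nseq ltnn eqxx mulr1z.
Qed.

(** Comparing the (0,2) entries of the computed and the true product, where (x E_01)(y E_12) = xy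
    E_02. Output entry (i, j) has flat number i * q + j, which [ga] splits again. *)
Lemma slp_bilinear (b : slp q) :
  (forall A B : 'M['M[R]_3]_q, slp_eval b A B = A *m B) ->
  exists al be ga : nat -> nat -> int, forall (X Y : nat -> R) i j,
    (i < q)%N -> (j < q)%N ->
    \sum_(z < q) X (i * q + z)%N * Y (z * q + j)%N =
    \sum_(t < slp_muls b) (lin N (al t) X * lin N (be t) Y) *~ ga (i * q + j)%N t.
Proof.
move=> hb; have [ps [sv [hs ha hv]]] := slp_forms (slp_code b).
pose d : (nat -> int) * (nat -> int) := (fun=> 0, fun=> 0).
pose ga e t : int := if insub (e %/ q)%N is Some i then
   if insub (e %% q)%N is Some j then (operand_form sv (slp_out b i j)).2`_t else 0
   else 0.
exists (fun t => (nth d ps t).1), (fun t => (nth d ps t).2), ga.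
move=> X Y i j hi hj.
move/matrixP: (hb (embA X) (embB Y)) => /(_ (Ordinal hi) (Ordinal hj)).
rewrite mxE /slp_vals hv operand_formE /form_val mxE.
have -> : \sum_z embA X (Ordinal hi) z * embB Y z (Ordinal hj) =
   tri3 0 0 (\sum_(z < q) X (i * q + z)%N * Y (z * q + j)%N).
  elim/big_rec2: _ => [|z u v _ ->]; first by rewrite tri30.
  by rewrite !mxE tri3M tri3D !addr0.
move=> /matrixP /(_ 0 (inord 2)).
have [_ _ ->] := tri3E (lin N (operand_form sv (slp_out b (Ordinal hi) (Ordinal hj))).1.1 X)
  (lin N (operand_form sv (slp_out b (Ordinal hi) (Ordinal hj))).1.2 Y)
  (\sum_(t < size ps) (lin N (nth d ps t).1 X * lin N (nth d ps t).2 Y) *~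
     (operand_form sv (slp_out b (Ordinal hi) (Ordinal hj))).2`_t).
have [_ _ ->] := tri3E 0 0 (\sum_(z < q) X (i * q + z)%N * Y (z * q + j)%N).
move=> <-; rewrite /slp_muls -hs; apply: eq_bigr => t _; congr (_ *~ _).
have q0 : (0 < q)%N by case: (q) hi.
rewrite /ga divnMDl // divn_small // addn0 modnMDl modn_small //.
by rewrite !insubT.
Qed.

(** If 1 has finite additive order n in [R], a prime divisor of n works; otherwise the integers
    embed in [R] and any prime does. Integer identities valid in [R] thus hold over a field, where
    ranks make sense. *)
Lemma prime_field_of_ring :
  exists2 p, prime p & forall z : int, z%:~R = 0 :> R -> z%:~R = 0 :> 'F_p.
Proof.
case: (boolp.EM (exists n, (0 < n)%N && (n%:R == 0 :> R))) => [ex|nex].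
  have := ex_minnP ex => -[n /andP[n0 /eqP nR] nmin].
  have n1 : (1 < n)%N.
    by case: n n0 nR {nmin} => [|[|n]] // _ /eqP; rewrite oner_eq0.
  exists (pdiv n); first exact: pdiv_prime.
  have natP (k : nat) : k%:R = 0 :> R -> k%:R = 0 :> 'F_(pdiv n).
    move=> kR; have dk : (n %| k)%N.
      apply/negPn/negP => nd.
      have kn : (k %% n)%N%:R = 0 :> R.
        have : (k %/ n * n + k %% n)%N%:R = 0 :> R by rewrite -divn_eq.
        by rewrite natrD natrM nR mulr0 add0r.
      have := nmin (k %% n)%N; rewrite lt0n nd kn eqxx leqNgt ltn_mod n0.
      by move=> /(_ isT).
    apply/eqP; rewrite -(dvdn_pcharf (pchar_Fp (pdiv_prime n1))).
    exact: dvdn_trans (pdiv_dvd _) dk.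
  case=> k; first by exact: natP.
  by rewrite NegzE !mulrNz => /eqP; rewrite oppr_eq0 => /eqP kR;
     apply/eqP; rewrite oppr_eq0; apply/eqP; exact: natP.
exists 2 => // z zR; suff -> : z = 0 by [].
have natP (k : nat) : k%:R = 0 :> R -> k = 0%N.
  move=> kR; case: k kR => // k kR; case: nex; exists k.+1; rewrite kR eqxx //.
case: z zR => k; first by move=> /natP ->.
by rewrite NegzE !mulrNz => /eqP; rewrite oppr_eq0 => /eqP /natP.
Qed.

Lemma flat_inj (i j k l : nat) : (j < q)%N -> (l < q)%N ->
  (i * q + j == k * q + l)%N = (i == k) && (j == l).
Proof.
move=> hj hl; apply/eqP/andP => [h|[/eqP -> /eqP -> //]].
have q0 : (0 < q)%N by case: (q) hj.
split; apply/eqP.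
  by move/(congr1 (fun x => x %/ q)%N): h; rewrite !divnMDl // !divn_small // !addn0.
by move/(congr1 (fun x => x %% q)%N): h; rewrite !modnMDl !modn_small.
Qed.

(* The linear map alpha of a bilinear algorithm is injective, so the rank is
   at least q ^ 2; were it q ^ 2, alpha would be onto and some X <> 0 would be
   used by a single product, making Y |-> X Y of rank 1. *)
Lemma bilinear_rank (r : nat) (al be ga : nat -> nat -> int) : (1 < q)%N ->
  (forall (X Y : nat -> R) i j, (i < q)%N -> (j < q)%N ->
    \sum_(z < q) X (i * q + z)%N * Y (z * q + j)%N =
    \sum_(t < r) (lin N (al t) X * lin N (be t) Y) *~ ga (i * q + j)%N t) ->
  (N < r)%N.
Proof.
move=> q1 H; have [p pp hp] := prime_field_of_ring.
have q0 : (0 < q)%N by apply: ltnW.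
pose F := 'F_p.
have linI e g : (e < N)%N -> lin N g (fun e' => (e' == e)%:R) = (g e)%:~R :> R.
  move=> lt; rewrite /lin (bigD1 (Ordinal lt)) //= eqxx big1 ?addr0 //.
  move=> k /eqP ne; case: eqP => [E|]; last by rewrite mul0rz.
  by case: ne; apply: val_inj.
(* The matrix multiplication tensor over the prime field, obtained by testing the identity on pairs
   of elementary matrices. *)
have T (a b c d i j : 'I_q) :
   \sum_(t < r) (al t (a * q + b)%N)%:~R * (be t (c * q + d)%N)%:~R *
       (ga (i * q + j)%N t)%:~R = ((a == i) && (b == c) && (d == j))%:R :> F.
  (* The difference is formed as one integer, so that its vanishing in [R] carries over to the prime
     field. *)
  have hz : ((\sum_(t < r) (al t (a * q + b)%N) * (be t (c * q + d)%N) *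
       (ga (i * q + j)%N t)) - ((a == i) && (b == c) && (d == j))%:R)%:~R = 0 :> R.
    rewrite intrD rmorph_sum mulrNz.
    have := H (fun e' => (e' == a * q + b)%N%:R) (fun e' => (e' == c * q + d)%N%:R)
      i j (ltn_ord _) (ltn_ord _).
    under [RHS]eq_bigr => t _ do
      rewrite !linI ?flat_lt // -intrM -mulrzA.
    move=> <-; apply/eqP; rewrite subr_eq0; apply/eqP.
    under eq_bigr => z _ do rewrite !flat_inj //.
    rewrite (bigD1 b) //= eqxx andbT big1 ?addr0 => [|z zb]; last first.
      have -> : (z == b :> nat) = false by exact: negPf zb.
      by rewrite andbF mul0r.
    rewrite -!val_eqE /= [(j == d :> nat)]eq_sym [(i == a :> nat)]eq_sym.
    by case: (_ == _); case: (_ == _); case: (_ == _); rewrite ?mulr1 ?mulr0 ?mul0r.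
  move/hp: hz => /eqP; rewrite intrD mulrNz subr_eq0 rmorph_sum => /eqP.
  under eq_bigr => t _ do rewrite /= !intrM.
  move=> ->; by case: (_ && _).
pose A : 'M[F]_(N, r) := \matrix_(e, t) (al t e)%:~R.
(* Contraction of the tensor with a matrix x in the first argument and E_(b,d) in the second: the
   left side is entry (i, j) of x E_(b,d). *)
have key (x : 'rV[F]_N) (i b d j : 'I_q) :
   x 0 (Ordinal (flat_lt i b)) * (d == j)%:R =
   \sum_(t < r) (x *m A) 0 t * (be t (b * q + d)%N)%:~R * (ga (i * q + j)%N t)%:~R.
  under eq_bigr => t _ do rewrite mxE -mulrA mulr_suml.
  rewrite exchange_big /=.
  pose y e := if insub e is Some o then x 0 o else 0.
  transitivity (\sum_(e < N) y e * \sum_(t < r) ((al t e)%:~R * (be t (b * q + d)%N)%:~R * (ga (i * q + j)%N t)%:~R)).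
    rewrite /N (sum_flat q q (fun e => y e * \sum_(t < r) ((al t e)%:~R * (be t (b * q + d)%N)%:~R * (ga (i * q + j)%N t)%:~R))).
    under eq_bigr => a _ do under eq_bigr => c _ do rewrite T.
    rewrite (bigD1 i) //= (bigD1 b) //= !eqxx /= [X in _ + X + _]big1 => [|c cb].
      rewrite [X in _ + X]big1 ?addr0 => [|a ai].
        by rewrite /y (insubT (fun e => e < N)%N (flat_lt i b)).
      by rewrite big1 // => c _; rewrite (negPf ai) /= mulr0.
    by rewrite (negPf cb) /= mulr0.
  apply: eq_bigr => e _; rewrite mulr_sumr; apply: eq_bigr => t _.
  rewrite mxE /y.
  rewrite (insubT (fun e => e < N)%N (ltn_ord e)) /=.
  rewrite !mulrA; congr (_ * _ * _ * _); congr (x 0 _); exact: val_inj.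
(* [key] with d = j = 0 recovers every entry of x from [x *m A]. *)
have inj (x : 'rV[F]_N) : x *m A = 0 -> x = 0.
  move=> x0; apply/rowP => e; rewrite mxE.
  have he : (e %/ q < q)%N by rewrite ltn_divLR // ltn_ord.
  have hm : (e %% q < q)%N by rewrite ltn_mod.
  have := key x (Ordinal he) (Ordinal hm) (Ordinal q0) (Ordinal q0).
  rewrite eqxx mulr1 x0 big1 => [|t _]; last by rewrite mxE !mul0r.
  by move=> <-; congr (x 0 _); apply: val_inj; rewrite /= -divn_eq.
have rf : row_free A.
  rewrite -kermx_eq0; apply/eqP/row_matrixP => i; rewrite row0.
  by apply: inj; rewrite -row_mul mulmx_ker row0.
rewrite ltnNge; apply/negP => rN.
have Nr : (N <= r)%N by rewrite -(eqP rf) rank_leq_col.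
have rfull : row_full A by rewrite /row_full (eqP rf) eqn_leq Nr rN.
have r0 : (0 < r)%N by apply: leq_trans Nr; rewrite muln_gt0 q0.
have [x xE] : exists x : 'rV[F]_N, x *m A = delta_mx 0 (Ordinal r0).
  have /submxP[x ->] : ((delta_mx 0 (Ordinal r0) : 'rV[F]_r) <= A)%MS by exact: submx_full.
  by exists x.
have xn0 : x != 0.
  apply/eqP => x0; move: xE; rewrite x0 mul0mx => /matrixP /(_ 0 (Ordinal r0)).
  by rewrite !mxE !eqxx => /esym/eqP; rewrite oner_eq0.
have key2 (i b d j : 'I_q) : x 0 (Ordinal (flat_lt i b)) * (d == j)%:R =
   (be 0 (b * q + d)%N)%:~R * (ga (i * q + j)%N 0%N)%:~R.
  rewrite key xE (bigD1 (Ordinal r0)) //= !mxE !eqxx mul1r big1 ?addr0 // => t ht.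
  by rewrite mxE (negPf ht) andbF !mul0r.
have [e xe] : exists e, x 0 e != 0.
  by apply/existsP; apply: contraNT xn0; rewrite negb_exists => /forallP h;
     apply/eqP/rowP => e; rewrite mxE; apply/eqP; move: (h e); rewrite negbK.
have he : (e %/ q < q)%N by rewrite ltn_divLR // ltn_ord.
have hm : (e %% q < q)%N by rewrite ltn_mod.
have xe' : x 0 (Ordinal (flat_lt (Ordinal he) (Ordinal hm))) != 0.
  rewrite (_ : Ordinal _ = e) //; by apply: val_inj; rewrite /= -divn_eq.
(* With a nonzero entry of x fixed, [key2] would write a nonzero multiple of the identity as a
   rank-one matrix u_d v_j. But u_0 v_1 = 0 forces u_0 v_0 = 0 or u_1 v_1 = 0; the index 1 exists
   because q > 1. *)
have h00 := key2 (Ordinal he) (Ordinal hm) (Ordinal q0) (Ordinal q0).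
have h01 := key2 (Ordinal he) (Ordinal hm) (Ordinal q0) (Ordinal q1).
have h11 := key2 (Ordinal he) (Ordinal hm) (Ordinal q1) (Ordinal q1).
rewrite eqxx mulr1 in h00; rewrite eqxx mulr1 in h11.
rewrite -val_eqE /= mulr0 in h01.
move/esym/eqP: h01; rewrite mulf_eq0 => /orP[/eqP Z|/eqP Z].
  by rewrite h00 /= Z mul0r eqxx in xe'.
by rewrite h11 /= Z mulr0 eqxx in xe'.
Qed.

End Bilinear.

(** * A structured language for the tensor-unit machine *)

Inductive expr := ER of nat | EC of nat | EO of op & expr & expr | ED of expr & expr.

(** Registers from k on serve as an evaluation stack: the left operand stays in k while the right
    one is computed from k + 1 upwards. *)
Fixpoint ecode (k : nat) (e : expr) : program :=
  match e with
  | ER i => [:: Move k i]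
  | EC c => [:: Imm k c]
  | EO o e1 e2 => ecode k e1 ++ ecode k.+1 e2 ++ [:: Arith o k k k.+1]
  | ED e1 e2 => ecode k e1 ++ ecode k.+1 e2 ++ [:: Div k k k.+1]
  end.

Fixpoint esize (e : expr) : nat :=
  match e with
  | ER _ | EC _ => 1
  | EO _ e1 e2 | ED e1 e2 => esize e1 + esize e2
  end.

Fixpoint ecost (e : expr) : nat :=
  match e with
  | ER _ | EC _ => 1
  | EO _ e1 e2 | ED e1 e2 => ecost e1 + ecost e2 + 1
  end.

Fixpoint ewf (e : expr) : bool :=
  match e with
  | ER i => (i < 40)%N
  | EC _ => true
  | EO _ e1 e2 | ED e1 e2 => ewf e1 && ewf e2
  end.

(* Registers from 40 on are scratch space for the evaluation of expressions. *)
Inductive cmd :=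
  | Skip
  | Assign of nat & expr
  | Ld of nat & expr
  | St of expr & nat
  | El of op & nat & nat & nat
  | Mov of nat & nat
  | Ten of expr & expr & expr
  | Seq of cmd & cmd
  | While of nat & nat & cmd.

Fixpoint clen (c : cmd) : nat :=
  match c with
  | Skip => 0
  | Assign _ e | Ld _ e | St e _ => ecost e + 1
  | El _ _ _ _ | Mov _ _ => 1
  | Ten a b d => ecost a + ecost b + ecost d + 1
  | Seq c1 c2 => clen c1 + clen c2
  | While _ _ c => clen c + 3
  end.

(** Jump targets are absolute, hence the address [off] of the first instruction. [Ten] takes its
    height from register 1, which holds s, so every call multiplies two s x s matrices. *)
Fixpoint compile (off : nat) (c : cmd) : program :=
  match c with
  | Skip => [::]
  | Assign k e => ecode 40 e ++ [:: Move k 40]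
  | Ld k e => ecode 40 e ++ [:: Read k 40]
  | St e k => ecode 40 e ++ [:: Write 40 k]
  | El o k i j => [:: Arith o k i j]
  | Mov k i => [:: Move k i]
  | Ten a b d => ecode 40 a ++ ecode 41 b ++ ecode 42 d ++ [:: Tensor 40 41 42 1]
  | Seq c1 c2 => compile off c1 ++ compile (off + clen c1) c2
  | While i j c => [:: JumpLt i j (off + 2)%N; Jump (off + clen c + 3)%N] ++
                   compile (off + 2) c ++ [:: Jump off]
  end.

Definition ewf64 (e : expr) : bool := ewf e && (esize e <= 64)%N.

Fixpoint cwf (c : cmd) : bool :=
  match c with
  | Skip => true
  | Assign k e | Ld k e | St e k => (k < 40)%N && ewf64 e
  | El _ k i j => [&& k < 40, i < 40 & j < 40]%N
  | Mov k i => (k < 40)%N && (i < 40)%N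
  | Ten a b d => [&& ewf64 a, ewf64 b & ewf64 d]
  | Seq c1 c2 => cwf c1 && cwf c2
  | While i j c => [&& i < 40, j < 40 & cwf c]%N
  end.

(** Used for registers, to protect the low-numbered ones, and for memory, to protect all cells below
    an address. *)
Definition keep (W : Type) (k : nat) (r r' : nat -> W) : Prop :=
  forall i, (i < k)%N -> r' i = r i.

Lemma keepW W k k' (r r' : nat -> W) : (k' <= k)%N -> keep k r r' -> keep k' r r'.
Proof. by move=> le h i hi; apply: h; apply: leq_trans le. Qed.

Lemma keep_trans W k (r1 r2 r3 : nat -> W) :
  keep k r1 r2 -> keep k r2 r3 -> keep k r1 r3.
Proof. by move=> h1 h2 i hi; rewrite h2 // h1. Qed.

Lemma size_ecode k e : size (ecode k e) = ecost e.
Proof.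
by elim: e k => //= [o|] e1 IH1 e2 IH2 k; rewrite !size_cat IH1 IH2 /= addnA.
Qed.

Lemma size_compile off c : size (compile off c) = clen c.
Proof.
elim: c off => //= [k e|k e|e k|a b d|c1 IH1 c2 IH2|i j c IH] off;
  rewrite ?size_cat ?size_ecode ?IH1 ?IH2 ?IH /= ?addnA //; lia.
Qed.

(* Every value held by a variable is at most V, and an expression with e leaves
   then evaluates to at most V ^ e: with e <= 64 nothing overflows. *)
Definition fits (V kappa : nat) : Prop := (V ^ 64 < 2 ^ kappa)%N.

(** * Overflow-free evaluation, big-step semantics and correctness of the compiler *)

Section Machine.
Variables (R : nzRingType) (kappa s l V : nat).
Hypothesis V2 : (2 <= V)%N.
Hypothesis V64 : fits V kappa.

Notation rg := (nat -> word R).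
Notation mm := (nat -> word R).

(** Exact arithmetic on natural numbers. It is undefined when a leaf exceeds V or a difference would
    be negative; where it is defined, for expressions of at most 64 leaves, it agrees with the
    modular arithmetic of the machine. *)
Fixpoint ev (r : rg) (e : expr) : option nat :=
  match e with
  | ER i => if r i is Int a then if (a <= V)%N then Some a else None else None
  | EC c => if (c <= V)%N then Some c else None
  | EO o e1 e2 =>
      if ev r e1 is Some a then if ev r e2 is Some b then
        match o with
        | Add => Some (a + b)%N
        | Mul => Some (a * b)%N
        | Defs.Sub => if (b <= a)%N then Some (a - b)%N else None
        end
      else None else None
  | ED e1 e2 =>
      if ev r e1 is Some a then if ev r e2 is Some b then Some (a %/ b)%N
      else None else None
  end.

Lemma esize_gt0 e : (0 < esize e)%N.
Proof. by elim: e => //= [o|] e1 h1 e2 h2; rewrite addn_gt0 h1. Qed.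

(** Each operand has a bound of at least V, hence at least 2, so the product of the bounds also
    dominates a sum. *)
Lemma ev_bound r e v : ev r e = Some v -> (v <= V ^ esize e)%N.
Proof.
elim: e v => [i|c|o e1 IH1 e2 IH2|e1 IH1 e2 IH2] v /=.
- by case: (r i) => // a; case: leqP => // h [<-]; rewrite expn1.
- by case: leqP => // h [<-]; rewrite expn1.
- case: (ev r e1) IH1 => // a /(_ _ erefl) h1.
  case: (ev r e2) IH2 => // b /(_ _ erefl) h2.
  have hm : (a * b <= V ^ (esize e1 + esize e2))%N by rewrite expnD leq_mul.
  have ha : (V <= V ^ esize e1)%N by rewrite -{1}[V]expn1 leq_exp2l // esize_gt0.
  have hb : (V <= V ^ esize e2)%N by rewrite -{1}[V]expn1 leq_exp2l // esize_gt0.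
  move: h1 h2 ha hb hm; rewrite expnD.
  move: (V ^ _)%N (V ^ _)%N => x y h1 h2 hx hy hm.
  case: o => [[<-]||[<-] //]; first nia.
  case: leqP => // _ [<-]; apply: leq_trans (leq_subr _ _) _.
  by apply: leq_trans h1 _; rewrite leq_pmulr //; lia.
- case: (ev r e1) IH1 => // a /(_ _ erefl) h1.
  case: (ev r e2) IH2 => // b _ [<-].
  apply: leq_trans (leq_div _ _) _; apply: leq_trans h1 _.
  by rewrite leq_exp2l // leq_addr.
Qed.

Lemma ev_small r e v : (esize e <= 64)%N -> ev r e = Some v -> (v < 2 ^ kappa)%N.
Proof.
move=> h /ev_bound hv; apply: leq_ltn_trans hv _; apply: leq_ltn_trans V64.
by rewrite leq_exp2l.
Qed.

Lemma ev_keep r r' e : ewf e -> keep 40 r r' -> ev r' e = ev r e.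
Proof.
move=> w k; elim: e w => //= [i hi|o e1 IH1 e2 IH2 /andP[/IH1 -> /IH2 -> //]|
  e1 IH1 e2 IH2 /andP[/IH1 -> /IH2 -> //]]; by rewrite k.
Qed.

Definition code_at (P : program) (off : nat) (code : program) :=
  exists pre post, P = pre ++ code ++ post /\ size pre = off.

Lemma code_atl P off c1 c2 : code_at P off (c1 ++ c2) -> code_at P off c1.
Proof.
by move=> [pre [post [-> h]]]; exists pre, (c2 ++ post); rewrite -catA.
Qed.

Lemma code_atr P off c1 c2 :
  code_at P off (c1 ++ c2) -> code_at P (off + size c1) c2.
Proof.
move=> [pre [post [-> h]]]; exists (pre ++ c1), post.
by rewrite size_cat h -!catA.
Qed.

Lemma code_at_nth P off i c : code_at P off (i :: c) -> nth Halt P off = i.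
Proof. by move=> [pre [post [-> <-]]]; rewrite nth_cat ltnn subnn. Qed.

Local Notation ex := (@exec R kappa s l).

Lemma exec_stepE P q r M q' r' M' c t st :
  step kappa s l P (State q r M) = Some (State q' r' M', c) ->
  ex P (State q' r' M') t st -> ex P (State q r M) (c + t) st.
Proof. exact: exec_step. Qed.

Lemma arith_int o (a b v : nat) : (v < 2 ^ kappa)%N -> (a < 2 ^ kappa)%N ->
  match o with
  | Add => Some (a + b)%N
  | Mul => Some (a * b)%N
  | Defs.Sub => if (b <= a)%N then Some (a - b)%N else None
  end = Some v -> arith kappa o (Int a : word R) (Int b) = Some (Int v).
Proof.
move=> hv ha; case: o => /= [[E]||[E]].
- by rewrite E modn_small.
- case: leqP => // ba [E]; congr (Some (Int _)).
  have -> : (a + (2 ^ kappa - b) = (a - b) + 2 ^ kappa)%N by lia.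
  by rewrite modnDr modn_small ?E.
- by rewrite E modn_small.
Qed.

(** [exec] describes halting runs only, so a code fragment is specified by prefixing its cost to any
    halting run that starts right after it. *)
Lemma ecode_exec P e off k r M v :
  code_at P off (ecode k e) -> (40 <= k)%N -> ewf e -> (esize e <= 64)%N ->
  ev r e = Some v ->
  exists r', [/\ keep k r r', r' k = Int v &
    forall t st, ex P (State (off + ecost e) r' M) t st ->
                 ex P (State off r M) (ecost e + t) st].
Proof.
elim: e off k r v => [i|c|o e1 IH1 e2 IH2|e1 IH1 e2 IH2] off k r v /=.
- move=> /code_at_nth h k40 hi _ hv; exists (upd r k (r i)); split.
  + by move=> j hj; rewrite /upd ltn_eqF.
  + by rewrite /upd eqxx; case: (r i) hv => // a; case: ifP => // _ [->].
  + by move=> t st; rewrite addn1; apply: exec_stepE; rewrite /= h.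
- move=> /code_at_nth h k40 hi sz hv; exists (upd r k (Int (c %% 2 ^ kappa)%N)); split.
  + by move=> j hj; rewrite /upd ltn_eqF.
  + rewrite /upd eqxx modn_small; first by move: hv; case: ifP => // _ [->].
    by apply: (@ev_small r (EC c)) => //=; move: hv; case: ifP.
  + by move=> t st; rewrite addn1; apply: exec_stepE; rewrite /= h.
- move=> hat k40 /andP[w1 w2] sz.
  case E1 : (ev r e1) => [a|] //; case E2 : (ev r e2) => [b|] // hv.
  have [|r1 [k1 v1 x1]] := IH1 off k r a (code_atl hat) k40 w1 _ E1; first by lia.
  have at2 := code_atr hat; rewrite size_ecode in at2.
  have [|||r2 [k2 v2 x2]] := IH2 _ k.+1 r1 b (code_atl at2) _ w2; try lia.
    by rewrite (ev_keep w2 (keepW k40 k1)).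
  have at3 := code_atr at2; rewrite size_ecode in at3.
  exists (upd r2 k (Int v)); split.
  + by move=> j hj; rewrite /upd ltn_eqF // k2 ?k1 // ltnS ltnW.
  + by rewrite /upd eqxx.
  + move=> t st ht; rewrite -!addnA; apply: x1; apply: x2.
    rewrite addn1 addnS addnA in ht; apply: exec_stepE ht.
    rewrite /= (code_at_nth at3) v2 k2 // v1.
    rewrite (arith_int (v := v)) //.
      by apply: (@ev_small r (EO o e1 e2)); rewrite //= E1 E2.
    by apply: (@ev_small r e1) => //; lia.
- move=> hat k40 /andP[w1 w2] sz.
  case E1 : (ev r e1) => [a|] //; case E2 : (ev r e2) => [b|] // [hv].
  have [|r1 [k1 v1 x1]] := IH1 off k r a (code_atl hat) k40 w1 _ E1; first by lia.
  have at2 := code_atr hat; rewrite size_ecode in at2.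
  have [|||r2 [k2 v2 x2]] := IH2 _ k.+1 r1 b (code_atl at2) _ w2; try lia.
    by rewrite (ev_keep w2 (keepW k40 k1)).
  have at3 := code_atr at2; rewrite size_ecode in at3.
  exists (upd r2 k (Int v)); split.
  + by move=> j hj; rewrite /upd ltn_eqF // k2 ?k1 // ltnS ltnW.
  + by rewrite /upd eqxx.
  + move=> t st ht; rewrite -!addnA; apply: x1; apply: x2.
    rewrite addn1 addnS addnA in ht; apply: exec_stepE ht.
    by rewrite /= (code_at_nth at3) v2 k2 // v1 hv.
Qed.

(** Big-step semantics with costs in which scratch registers do not appear. A failed loop test costs
    2 for the test and the jump out; a successful one costs 2 for the test and the jump back. *)
Inductive bs : cmd -> rg -> mm -> nat -> rg -> mm -> Prop :=
  | BSkip r M : bs Skip r M 0 r M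
  | BAssign k e r M v : ev r e = Some v ->
      bs (Assign k e) r M (ecost e + 1) (upd r k (Int v)) M
  | BLd k e r M a : ev r e = Some a ->
      bs (Ld k e) r M (ecost e + 1) (upd r k (M a)) M
  | BSt k e r M a : ev r e = Some a ->
      bs (St e k) r M (ecost e + 1) r (upd M a (r k))
  | BEl o k i j r M x y : r i = Elt x -> r j = Elt y ->
      bs (El o k i j) r M 1 (upd r k (Elt (ring_op o x y))) M
  | BMov k i r M : bs (Mov k i) r M 1 (upd r k (r i)) M
  | BTen ea eb ed r M a b d : ev r ea = Some a -> ev r eb = Some b ->
      ev r ed = Some d -> r 1%N = Int s ->
      [&& s <= V, a <= V, b <= V & d <= V]%N ->
      holds_mx M a s s -> holds_mx M b s s ->
      bs (Ten ea eb ed) r M (ecost ea + ecost eb + ecost ed + (s * s + l)) r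
         (store_mx M d (load_mx M a s s *m load_mx M b s s))
  | BSeq c1 c2 r M t1 r1 M1 t2 r2 M2 : bs c1 r M t1 r1 M1 -> bs c2 r1 M1 t2 r2 M2 ->
      bs (Seq c1 c2) r M (t1 + t2) r2 M2
  | BWhileF i j c r M a b : r i = Int a -> r j = Int b -> (b <= a)%N ->
      bs (While i j c) r M 2 r M
  | BWhileT i j c r M a b t1 r1 M1 t2 r2 M2 : r i = Int a -> r j = Int b ->
      (a < b)%N -> bs c r M t1 r1 M1 -> bs (While i j c) r1 M1 t2 r2 M2 ->
      bs (While i j c) r M (t1 + t2 + 2) r2 M2.

Lemma keep_upd k (r r' : rg) i w : keep k r r' -> keep k (upd r i w) (upd r' i w).
Proof. by move=> h j hj; rewrite /upd; case: ifP => // _; apply: h. Qed.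

(** A simulation up to scratch space, by induction on the big-step derivation: the machine registers
    [rc] need to agree with [r] below 40 only. *)
Lemma compile_exec c r M t r' M' : bs c r M t r' M' ->
  forall P off rc, cwf c -> code_at P off (compile off c) -> keep 40 r rc ->
  exists2 rc', keep 40 r' rc' & forall t2 st,
    ex P (State (off + clen c) rc' M') t2 st -> ex P (State off rc M) (t + t2) st.
Proof.
elim=> {c r M t r' M'}.
- by move=> r M P off rc _ _ h; exists rc => // t2 st; rewrite /= addn0.
- move=> k e r M v hv P off rc /andP[hk /andP[w sz]] hat hr.
  have hv' : ev rc e = Some v by rewrite (ev_keep w hr).
  have [r1 [k1 v1 x1]] := ecode_exec M (code_atl hat) (leqnn _) w sz hv'.
  have at2 := code_atr hat; rewrite size_ecode in at2.
  exists (upd r1 k (Int v)); first exact/keep_upd/(keep_trans hr).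
  move=> t2 st h; rewrite -addnA; apply: x1; apply: exec_stepE h.
  by rewrite /= (code_at_nth at2) v1 addn1 addnS.
- move=> k e r M v hv P off rc /andP[hk /andP[w sz]] hat hr.
  have hv' : ev rc e = Some v by rewrite (ev_keep w hr).
  have [r1 [k1 v1 x1]] := ecode_exec M (code_atl hat) (leqnn _) w sz hv'.
  have at2 := code_atr hat; rewrite size_ecode in at2.
  exists (upd r1 k (M v)); first exact/keep_upd/(keep_trans hr).
  move=> t2 st h; rewrite -addnA; apply: x1; apply: exec_stepE h.
  by rewrite /= (code_at_nth at2) v1 addn1 addnS.
- move=> k e r M v hv P off rc /andP[hk /andP[w sz]] hat hr.
  have hv' : ev rc e = Some v by rewrite (ev_keep w hr).
  have [r1 [k1 v1 x1]] := ecode_exec M (code_atl hat) (leqnn _) w sz hv'.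
  have at2 := code_atr hat; rewrite size_ecode in at2.
  exists r1; first exact: keep_trans k1.
  move=> t2 st h; rewrite -addnA; apply: x1; apply: exec_stepE h.
  by rewrite /= (code_at_nth at2) v1 addn1 addnS k1 // hr.
- move=> o k i j r M x y hi hj P off rc /and3P[wk wi wj] hat hr.
  exists (upd rc k (Elt (ring_op o x y))); first exact: keep_upd.
  move=> t2 st; rewrite /= addn1; apply: exec_stepE.
  by rewrite /= (code_at_nth hat) hr // hi hr // hj.
- move=> k i r M P off rc /andP[wk wi] hat hr.
  exists (upd rc k (r i)); first exact: keep_upd.
  move=> t2 st; rewrite /= addn1; apply: exec_stepE.
  by rewrite /= (code_at_nth hat) hr.
- move=> ea eb ed r M a b d ha hb hd h1 /and4P[sV aV bV dV] hA hB P off rc.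
  move=> /and3P[/andP[wa sa] /andP[wb sb] /andP[wd sd]] hat hr.
  have ha' : ev rc ea = Some a by rewrite (ev_keep wa hr).
  have [r1 [k1 v1 x1]] := ecode_exec M (code_atl hat) (leqnn _) wa sa ha'.
  have at2 := code_atr hat; rewrite size_ecode in at2.
  have hb' : ev r1 eb = Some b by rewrite (ev_keep wb k1) (ev_keep wb hr).
  have [r2 [k2 v2 x2]] := ecode_exec M (code_atl at2) (isT : 40 <= 41)%N wb sb hb'.
  have at3 := code_atr at2; rewrite size_ecode in at3.
  have k2' := keepW (isT : 40 <= 41)%N k2.
  have hd' : ev r2 ed = Some d.
    by rewrite (ev_keep wd k2') (ev_keep wd k1) (ev_keep wd hr).
  have [r3 [k3 v3 x3]] := ecode_exec M (code_atl at3) (isT : 40 <= 42)%N wd sd hd'.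
  have at4 := code_atr at3; rewrite size_ecode in at4.
  exists r3; first exact: keep_trans (keep_trans (keep_trans hr k1) k2')
     (keepW (isT : 40 <= 42)%N k3).
  move=> t2 st h; rewrite -!addnA; apply: x1; apply: x2; apply: x3.
  rewrite /= addn1 addnS !addnA in h; rewrite addnA; apply: exec_stepE h.
  rewrite /= (code_at_nth at4) v3 !k3 // v2 !k2 // v1 k1 // hr // h1.
  (* Operands of the tensor unit fit into memory since V + V^2 <= V^3 <= V^64 < 2^kappa. *)
  have big x : (x <= V)%N -> (x + s * s <= 2 ^ kappa)%N.
    move=> hx; apply: ltnW; apply: leq_ltn_trans V64.
    have h3 : (V ^ 3 <= V ^ 64)%N by rewrite leq_exp2l.
    apply: leq_trans h3; apply: (@leq_trans (V + V * V)%N).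
      by rewrite leq_add // leq_mul.
    by rewrite !expnS expn0; nia.
  by rewrite leqnn !big //= hA hB.
- move=> c1 c2 r M t1 r1 M1 t2 r2 M2 _ IH1 _ IH2 P off rc /andP[w1 w2] hat hr.
  have [ra hra xa] := IH1 P off rc w1 (code_atl hat) hr.
  have at2 := code_atr hat; rewrite size_compile in at2.
  have [rb hrb xb] := IH2 P _ ra w2 at2 hra.
  exists rb => // t st h; rewrite -addnA; apply: xa; apply: xb.
  by rewrite -addnA.
- move=> i j c r M a b hi hj ba P off rc /and3P[wi wj wc] hat hr.
  exists rc => // t st h.
  have at2 := code_atr (hat : code_at P off ([:: JumpLt i j (off + 2)%N] ++ _)).
  apply: (exec_stepE (c := 1) (t := (1 + t)%N)).
    by rewrite /= (code_at_nth hat) hr // hi hr // hj ltnNge ba.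
  apply: exec_stepE.
    by rewrite /= -addn1 (code_at_nth at2).
  by rewrite -addnA.
- move=> i j c r M a b t1 r1 M1 t2 r2 M2 hi hj ab _ IH1 _ IH2 P off rc w hat hr.
  have /and3P[wi wj wc] := w.
  have atc := code_atl (code_atr (hat : code_at P off
     ([:: JumpLt i j (off + 2)%N; _] ++ (_ ++ _)))).
  have atj := code_atr (code_atr (hat : code_at P off
     ([:: JumpLt i j (off + 2)%N; _] ++ (_ ++ _)))).
  rewrite size_compile in atj.
  have [ra hra xa] := IH1 P _ rc wc atc hr.
  have [rb hrb xb] := IH2 P off ra w hat hra.
  exists rb => // t st h.
  rewrite (_ : (t1 + t2 + 2 + t = 1 + (t1 + (1 + (t2 + t))))%N); last by lia.
  apply: exec_stepE.
    by rewrite /= (code_at_nth hat) hr // hi hr // hj ab.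
  apply: xa; apply: exec_stepE; first by rewrite /= (code_at_nth atj).
  exact: xb.
Qed.

(** * Weakest preconditions with a time budget *)

Definition wp (c : cmd) (Q : rg -> mm -> Prop) (r : rg) (M : mm) (T : nat) : Prop :=
  exists t r' M', [/\ bs c r M t r' M', (t <= T)%N & Q r' M'].

Lemma wp_mono c (Q Q' : rg -> mm -> Prop) r M T T' : wp c Q r M T ->
  (forall r M, Q r M -> Q' r M) -> (T <= T')%N -> wp c Q' r M T'.
Proof.
move=> [t [r' [M' [h1 h2 h3]]]] h le; exists t, r', M'; split=> //; last exact: h.
exact: leq_trans le.
Qed.

Lemma wp_seq c1 c2 Q r M T1 T2 :
  wp c1 (fun r M => wp c2 Q r M T2) r M T1 -> wp (Seq c1 c2) Q r M (T1 + T2).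
Proof.
move=> [t1 [r1 [M1 [h1 l1 [t2 [r2 [M2 [h2 l2 q]]]]]]]].
exists (t1 + t2)%N, r2, M2; split=> //; last exact: leq_add.
exact: BSeq h2.
Qed.

(** A precondition that computes: on loop-free code, simplification performs symbolic execution and
    leaves the postcondition at the final state. Loops get [False] here and are treated by separate
    rules for [wp]. *)
Fixpoint sl (c : cmd) (Q : rg -> mm -> Prop) (r : rg) (M : mm) {struct c} : Prop :=
  match c with
  | Skip => Q r M
  | Assign k e => if ev r e is Some v then Q (upd r k (Int v)) M else False
  | Ld k e => if ev r e is Some a then Q (upd r k (M a)) M else False
  | St e k => if ev r e is Some a then Q r (upd M a (r k)) else False
  | El o k i j => if (r i, r j) is (Elt x, Elt y)
                  then Q (upd r k (Elt (ring_op o x y))) M else False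
  | Mov k i => Q (upd r k (r i)) M
  | Ten ea eb ed =>
      if (ev r ea, ev r eb, ev r ed) is (Some a, Some b, Some d) then
        [/\ r 1%N = Int s, [&& s <= V, a <= V, b <= V & d <= V]%N,
            holds_mx M a s s, holds_mx M b s s &
            Q r (store_mx M d (load_mx M a s s *m load_mx M b s s))]
      else False
  | Seq c1 c2 => sl c1 (sl c2 Q) r M
  | While _ _ _ => False
  end.

Fixpoint cost (c : cmd) : nat :=
  match c with
  | Assign _ e | Ld _ e | St e _ => ecost e + 1
  | El _ _ _ _ | Mov _ _ => 1
  | Ten a b d => ecost a + ecost b + ecost d + (s * s + l)
  | Seq c1 c2 => cost c1 + cost c2
  | _ => 0
  end.

Lemma wp_sl c Q r M : sl c Q r M -> wp c Q r M (cost c).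
Proof.
elim: c Q r M => [|k e|k e|e k|o k i j|k i|ea eb ed|c1 IH1 c2 IH2|//] Q r M /=.
- by move=> h; exists 0%N, r, M; split=> //; constructor.
- by case E : (ev r e) => [v|] // h; do 3!eexists; split; [constructor; exact: E| |exact: h].
- by case E : (ev r e) => [v|] // h; do 3!eexists; split; [constructor; exact: E| |exact: h].
- by case E : (ev r e) => [v|] // h; do 3!eexists; split; [constructor; exact: E| |exact: h].
- case Ei : (r i) => [|x] //; case Ej : (r j) => [|y] // h.
  by do 3!eexists; split; [apply: BEl; [exact: Ei|exact: Ej]| |exact: h].
- by move=> h; do 3!eexists; split; [constructor| |exact: h].
- case Ea : (ev r ea) => [a|] //; case Eb : (ev r eb) => [b|] //.
  case Ed : (ev r ed) => [d|] // [h1 h2 h3 h4 h5].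
  do 3!eexists; split; [|exact: leqnn|exact: h5].
  exact: (BTen Ea Eb Ed).
- move=> /IH1 h; apply: wp_seq; apply: wp_mono h _ (leqnn _).
  by move=> r' M'; apply: IH2.
Qed.

Lemma wp_slseq c1 c2 Q r M T :
  sl c1 (fun r M => wp c2 Q r M T) r M -> wp (Seq c1 c2) Q r M (cost c1 + T).
Proof. by move=> h; apply/wp_seq/wp_sl. Qed.

Lemma sl_mono c (Q Q' : rg -> mm -> Prop) r M :
  sl c Q r M -> (forall r M, Q r M -> Q' r M) -> sl c Q' r M.
Proof.
elim: c Q Q' r M => [|k e|k e|e k|o k i j|k i|ea eb ed|c1 IH1 c2 IH2|//] Q Q' r M /= h hQ;
  first by exact: hQ.
- by case: (ev r e) h => // v; apply: hQ.
- by case: (ev r e) h => // v; apply: hQ.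
- by case: (ev r e) h => // v; apply: hQ.
- by case: (r i) h => // x; case: (r j) => // y; apply: hQ.
- exact: hQ.
- case: (ev r ea) h => // a; case: (ev r eb) => // b; case: (ev r ed) => // d.
  by case=> *; split=> //; apply: hQ.
- by apply: (IH1 _ _ _ _ h) => r' M' h'; apply: (IH2 _ _ _ _ h').
Qed.

Definition For (k lim : nat) (body : cmd) : cmd :=
  Seq (Assign k (EC 0))
      (While k lim (Seq body (Assign k (EO Add (ER k) (EC 1))))).

(** The 6 extra units per round are 4 for the increment and 2 for test and jump; the final 4 are 2
    for the initialisation and 2 for leaving the loop. The limit sits in a register below the
    counter, so [keep] protects it from the body. *)
Lemma wp_for (k lim : nat) (body : cmd) (I : nat -> mm -> Prop) (N B : nat) r0 M0 :
  (lim < k)%N -> r0 lim = Int N -> (N <= V)%N -> I 0%N M0 ->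
  (forall j r M, (j < N)%N -> keep k r0 r -> r k = Int j -> I j M ->
     wp body (fun r' M' => keep k.+1 r r' /\ I j.+1 M') r M B) ->
  wp (For k lim body) (fun r' M' => keep k r0 r' /\ I N M') r0 M0 (N * (B + 6) + 4).
Proof.
move=> lk hN NV I0 step.
have V1 : (1 <= V)%N by apply: ltnW.
suff loop n j r M : (n + j = N)%N -> keep k r0 r -> r k = Int j -> I j M ->
    wp (While k lim (Seq body (Assign k (EO Add (ER k) (EC 1)))))
      (fun r' M' => keep k r0 r' /\ I N M') r M (n * (B + 6) + 2).
  rewrite (_ : (N * (B + 6) + 4 = 2 + (N * (B + 6) + 2))%N); last by lia.
  apply: wp_slseq => /=; apply: loop (addn0 N) _ _ _ => //.
    by move=> i hi; rewrite /upd ltn_eqF.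
  by rewrite /upd eqxx.
elim: n j r M => [|n IH] j r M nj kp rj Ij.
  exists 2%N, r, M; split=> //; last by rewrite -nj.
  by apply: BWhileF rj (_ : _ = Int N) _; rewrite ?kp // -nj.
have jN : (j < N)%N by lia.
have [t1 [r1 [M1 [b1 l1 [kp1 I1]]]]] := step j r M jN kp rj Ij.
have r1k : r1 k = Int j by rewrite kp1.
have a1 : bs (Assign k (EO Add (ER k) (EC 1))) r1 M1 4 (upd r1 k (Int (j + 1)%N)) M1.
  by apply: BAssign; rewrite /= r1k V1 (leq_trans (ltnW jN)).
have kp2 : keep k r0 (upd r1 k (Int (j + 1)%N)).
  by move=> i hi; rewrite /upd ltn_eqF // kp1 ?kp // ltnS ltnW.
have [|||t2 [r2 [M2 [b2 l2 h]]]] := IH (j + 1)%N _ M1 _ kp2; first by lia.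
- by rewrite /upd eqxx.
- by rewrite addn1.
exists (t1 + 4 + t2 + 2)%N, r2, M2; split=> //; last by lia.
by apply: BWhileT rj (_ : _ = Int N) jN (BSeq b1 a1) b2; rewrite kp.
Qed.

End Machine.

Section Rules.
Variables (R : nzRingType) (s l V : nat).
Notation rg := (nat -> word R).
Notation mm := (nat -> word R).
Local Notation wp := (@wp R s l V).

Lemma wp_le c Q (r : rg) (M : mm) T T' : wp c Q r M T -> (T <= T')%N -> wp c Q r M T'.
Proof. by move=> h; apply: wp_mono h _. Qed.

Lemma wp_whileF i j c (Q : rg -> mm -> Prop) r M a b : r i = Int a -> r j = Int b ->
  (b <= a)%N -> Q r M -> wp (While i j c) Q r M 2.
Proof. by move=> hi hj ba q; exists 2%N, r, M; split=> //; apply: BWhileF ba. Qed.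

Lemma wp_whileT i j c (Q : rg -> mm -> Prop) r M a b T1 T2 : r i = Int a -> r j = Int b ->
  (a < b)%N -> wp c (fun r M => wp (While i j c) Q r M T2) r M T1 ->
  wp (While i j c) Q r M (T1 + T2 + 2).
Proof.
move=> hi hj ab [t1 [r1 [M1 [b1 l1 [t2 [r2 [M2 [b2 l2 q]]]]]]]].
exists (t1 + t2 + 2)%N, r2, M2; split=> //; last by lia.
exact: BWhileT hi hj ab b1 b2.
Qed.

End Rules.

(** * Level-by-level recursion *)

Declare Scope expr_scope.
Delimit Scope expr_scope with xp.
Arguments EO _ _%_xp _%_xp.
Arguments ED _%_xp _%_xp.
Bind Scope expr_scope with expr.
Local Notation "a + b" := (EO Add a b) : expr_scope.
Local Notation "a - b" := (EO Defs.Sub a b) : expr_scope.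
Local Notation "a * b" := (EO Mul a b) : expr_scope.
Local Notation "a / b" := (ED a b) : expr_scope.
Local Notation "# k" := (ER k) (at level 1, format "# k") : expr_scope.
Arguments Assign _%_N _%_xp.
Arguments Ld _%_N _%_xp.
Arguments St _%_xp _%_N.
Arguments Ten _%_xp _%_xp _%_xp.

Definition seqs : seq cmd -> cmd := foldr Seq Skip.

(** The machine cannot multiply a ring element by an integer, so the multiple is unrolled into |g|
    additions or subtractions. As g is a coefficient of the base algorithm, this is constant
    work. *)
Definition addmul (g : int) : seq cmd :=
  nseq `|g|%N (El (if 0 <= g then Add else Defs.Sub) 26 26 28).

Definition lin_in (g : nat -> int) (raddr : nat -> expr) (es : seq nat) : seq cmd :=
  flatten [seq Ld 28 (raddr e) :: addmul (g e) | e <- es].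

Definition row (g : nat -> int) (nin : nat) (raddr : nat -> expr) (waddr : expr) :
    seq cmd :=
  Mov 26 5 :: lin_in g raddr (iota 0 nin) ++ [:: St waddr 26].

Definition rows (G : nat -> nat -> int) (nin : nat) (raddr waddr : nat -> expr)
    (ts : seq nat) : seq cmd :=
  flatten [seq row (G t) nin raddr (waddr t) | t <- ts].

Fixpoint noten (c : cmd) : bool :=
  match c with
  | Ten _ _ _ => false
  | Seq c1 c2 => noten c1 && noten c2
  | _ => true
  end.

(** Only tensor calls have a cost depending on s and l, so the constants of the passes depend on the
    base algorithm alone. *)
Lemma cost_noten s l c : noten c -> cost s l c = cost 0 0 c.
Proof. by elim: c => //= c1 IH1 c2 IH2 /andP[/IH1 -> /IH2 ->]. Qed.

Lemma all_seqs (P : cmd -> bool) cs : P Skip ->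
  (forall c1 c2, P c1 -> P c2 -> P (Seq c1 c2)) -> all P cs -> P (seqs cs).
Proof. by move=> h0 hS; elim: cs => //= c cs IH /andP[h1 /IH]; apply: hS. Qed.

Lemma all_rows (P : cmd -> bool) G nin raddr waddr ts :
  P (Mov 26 5) -> (forall e, P (Ld 28 (raddr e))) -> (forall t, P (St (waddr t) 26)) ->
  (forall o, P (El o 26 26 28)) -> all P (rows G nin raddr waddr ts).
Proof.
move=> hM hL hS hE; rewrite /rows; elim: ts => //= t ts IH; rewrite hM /= all_cat IH andbT.
rewrite all_cat /= hS !andbT /lin_in.
elim: (iota 0 nin) => //= e es IHe; rewrite hL all_cat IHe andbT /=.
by rewrite /addmul all_nseq hE orbT.
Qed.

Section Rows.
Variables (R : nzRingType) (s l V : nat).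
Notation rg := (nat -> word R).
Notation mm := (nat -> word R).
Local Notation sl := (@sl R s V).
Local Notation ev := (@ev R V).

Lemma sl_addmul g cs Q r M x y : r 26%N = Elt x -> r 28%N = Elt y ->
  (forall r' : rg, (forall i, i != 26%N -> r' i = r i) ->
     r' 26%N = Elt (x + y *~ g) -> sl (seqs cs) Q r' M) ->
  sl (seqs (addmul g ++ cs)) Q r M.
Proof.
rewrite /addmul => hx hy H.
have E : y *~ g = (if 0 <= g then y else - y) *+ `|g|%N.
  case: g {H} => n; first by rewrite lez_nat leq0n.
  by rewrite NegzE mulrNz -pmulrn /= mulNrn.
rewrite E in H; move: (`|g|%N) (0 <= g) H => n b {E g}.
elim: n r x hx hy => [|n IH] r x hx hy H /=.
  by apply: H => //; rewrite mulr0n addr0.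
rewrite hx hy.
apply: (IH _ (ring_op (if b then Add else Defs.Sub) x y)) => //.
move=> r' k1 k2; apply: H.
  by move=> i hi; rewrite k1 // /upd (negPf hi).
by rewrite k2 mulrS addrA; case: (b).
Qed.

Lemma sl_lin_in (g f : nat -> _) raddr es cs Q (r : rg) M x :
  r 26%N = Elt x ->
  (forall e, e \in es -> forall r', keep 26 r r' ->
     exists2 a, ev r' (raddr e) = Some a & M a = Elt (f e)) ->
  (forall r', keep 26 r r' -> r' 26%N = Elt (x + \sum_(e <- es) f e *~ g e) ->
     sl (seqs cs) Q r' M) ->
  sl (seqs (lin_in g raddr es ++ cs)) Q r M.
Proof.
elim: es r x => [|e es IH] r x hx hr H.
  by apply: H => //; rewrite big_nil addr0.
rewrite /lin_in /= -catA.
have [a -> Ma] := hr e (mem_head _ _) r (fun _ _ => erefl).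
rewrite Ma; apply: (sl_addmul (x := x) (y := f e)) => // r1 k1 h1.
have kr : keep 26 r r1.
  by move=> i hi; rewrite k1 ?ltn_eqF // /upd !ltn_eqF // (leq_trans hi).
apply: (IH _ _ h1).
  move=> e' he r' kr'; apply: hr; first by rewrite inE he orbT.
  exact: keep_trans kr'.
move=> r' kr' h'; apply: H; first exact: keep_trans kr'.
by rewrite h' big_cons addrA.
Qed.

(** Every write to a cell a stores [v a], so a cell once correct stays correct even if it is written
    again, and injectivity of the addresses need not be proved. Reads lie below [dst] and writes at
    or above it, so inputs survive. *)
Lemma sl_rows (G : nat -> nat -> int) nin raddr waddr ts (Q : rg -> mm -> Prop)
    (r : rg) (M : mm) (f : nat -> R) (ra wa : nat -> nat) (v : nat -> R) dst :
  r 5%N = Elt 0 ->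
  (forall e, (e < nin)%N -> forall r', keep 26 r r' -> ev r' (raddr e) = Some (ra e)) ->
  (forall t, t \in ts -> forall r', keep 26 r r' -> ev r' (waddr t) = Some (wa t)) ->
  (forall e, (e < nin)%N -> (ra e < dst)%N /\ M (ra e) = Elt (f e)) ->
  (forall t, t \in ts -> (dst <= wa t)%N) ->
  (forall t, t \in ts -> \sum_(e < nin) f e *~ G t e = v (wa t)) ->
  (forall r' M', keep 26 r r' -> keep dst M M' ->
     (forall a, M' a = M a \/ M' a = Elt (v a)) ->
     (forall t, t \in ts -> M' (wa t) = Elt (v (wa t))) -> Q r' M') ->
  sl (seqs (rows G nin raddr waddr ts)) Q r M.
Proof.
elim: ts r M => [|t ts IH] r M h5 hra hwa hM hd hv H.
  by apply: H => // a; left.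
have E : rows G nin raddr waddr (t :: ts) = Mov 26 5 ::
   lin_in (G t) raddr (iota 0 nin) ++ (St (waddr t) 26 :: rows G nin raddr waddr ts).
  by rewrite /rows /= /row -[RHS]/(_ :: _ ++ _) -!catA.
rewrite E /= h5.
apply: (sl_lin_in (f := f) (x := 0)); first by [].
  move=> e; rewrite mem_iota add0n => /= he r' kr'.
  exists (ra e); last by have [] := hM e he.
  by apply: hra => // i hi; rewrite kr' // /upd ltn_eqF.
move=> r1 kr1 h1.
have kr : keep 26 r r1 by move=> i hi; rewrite kr1 // /upd ltn_eqF.
rewrite /= (hwa t (mem_head _ _) _ kr) h1 add0r.
have -> : \sum_(e <- iota 0 nin) f e *~ G t e = v (wa t).
  by rewrite -hv ?mem_head // -(big_mkord xpredT (fun e => f e *~ G t e)) /index_iota subn0.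
have kM : keep dst M (upd M (wa t) (Elt (v (wa t)))).
  move=> a ha; rewrite /upd ltn_eqF //; apply: leq_trans ha _.
  exact/hd/mem_head.
apply: (IH).
- by rewrite kr.
- by move=> e he r' kr'; apply: hra => //; apply: keep_trans kr'.
- move=> t' ht r' kr'; apply: hwa; first by rewrite inE ht orbT.
  exact: keep_trans kr'.
- by move=> e he; have [h2 h3] := hM e he; rewrite kM.
- by move=> t' ht; apply: hd; rewrite inE ht orbT.
- by move=> t' ht; apply: hv; rewrite inE ht orbT.
move=> r' M' kr' kM' hor hts; apply: H.
- exact: keep_trans kr'.
- exact: keep_trans kM'.
- move=> a; case: (hor a) => ->; last by right.
  by rewrite /upd; case: eqP => [->|]; [right|left].
- move=> t'; rewrite inE => /orP[/eqP ->|]; last exact: hts.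
  by case: (hor (wa t)) => ->; rewrite /upd ?eqxx.
Qed.

Hypothesis V2 : (2 <= V)%N.
Local Notation wp := (@wp R s l V).

Lemma wp_pass pre (G : nat -> nat -> int) nout nin raddr waddr N (r0 : rg) (M0 : mm)
    (f : nat -> nat -> R) (ra wa : nat -> nat -> nat) (v : nat -> R) dst :
  r0 11%N = Int N -> (N <= V)%N -> r0 5%N = Elt 0 ->
  (forall j r M, (j < N)%N -> keep 20 r0 r -> r 20%N = Int j ->
    sl pre (fun r' M' => [/\ M' = M, keep 21 r r',
      forall e, (e < nin)%N -> forall r'', keep 26 r' r'' ->
        ev r'' (raddr e) = Some (ra j e) &
      forall t, (t < nout)%N -> forall r'', keep 26 r' r'' ->
        ev r'' (waddr t) = Some (wa j t)]) r M) ->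
  (forall j e, (j < N)%N -> (e < nin)%N ->
     (ra j e < dst)%N /\ M0 (ra j e) = Elt (f j e)) ->
  (forall j t, (j < N)%N -> (t < nout)%N -> (dst <= wa j t)%N) ->
  (forall j t, (j < N)%N -> (t < nout)%N ->
     \sum_(e < nin) f j e *~ G t e = v (wa j t)) ->
  let body := Seq pre (seqs (rows G nin raddr waddr (iota 0 nout))) in
  wp (For 20 11 body) (fun r' M' => [/\ keep 20 r0 r', keep dst M0 M' &
       forall j t, (j < N)%N -> (t < nout)%N -> M' (wa j t) = Elt (v (wa j t))])
     r0 M0 (N * (cost s l body + 6) + 4).
Proof.
move=> h11 NV h5 hpre hra hwa hv body.
pose I j (M : mm) := keep dst M0 M /\ forall j' t, (j' < j)%N -> (t < nout)%N ->
   M (wa j' t) = Elt (v (wa j' t)).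
have := @wp_for R s l V V2 20 11 body I N (cost s l body) r0 M0 isT h11 NV.
move=> /(_ (conj (fun _ _ => erefl) _)) W.
apply: (wp_mono (W _ _) _ (leqnn _)) => //; last by move=> r M [k [h1 h2]]; split.
move=> j r M jN kr rj [kM Iv]; apply: wp_sl => /=.
apply: sl_mono (hpre j r M jN kr rj) _ => r1 M1 [-> k1 er ew].
apply: (sl_rows (f := f j) (ra := ra j) (wa := wa j) (v := v) (dst := dst)).
- by rewrite k1 // kr.
- exact: er.
- by move=> t; rewrite mem_iota => /= ht; apply: ew.
- by move=> e he; have [h1 h2] := hra j e jN he; rewrite kM.
- by move=> t; rewrite mem_iota => /= ht; apply: hwa.
- by move=> t; rewrite mem_iota => /= ht; apply: hv.
move=> r2 M2 k2 kM2 hor hts; split.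
  by apply: keep_trans k1 _; apply: keepW k2.
split; first exact: keep_trans kM2.
move=> j' t; rewrite ltnS leq_eqVlt => /orP[/eqP ->|lt] ht.
  by apply: hts; rewrite mem_iota.
by case: (hor (wa j' t)) => ->; rewrite ?Iv.
Qed.

End Rows.

Lemma flat3K S q x y : (x < S)%N -> (y < S)%N ->
  [/\ ((q * S + x) * S + y) %/ S %/ S = q,
      ((q * S + x) * S + y) %/ S %% S = x &
      ((q * S + x) * S + y) %% S = y]%N.
Proof.
move=> hx hy; have S0 : (0 < S)%N by apply: leq_trans hx.
rewrite divnMDl // (divn_small hy) addn0 divnMDl // (divn_small hx) addn0.
by rewrite !modnMDl !modn_small.
Qed.

Lemma flat3_lt Q S q x y : (q < Q)%N -> (x < S)%N -> (y < S)%N ->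
  ((q * S + x) * S + y < Q * S * S)%N.
Proof.
move=> hq hx hy; have h1 : (q * S + x < Q * S)%N by nia.
by move: (Q * S)%N h1 => A h1; nia.
Qed.

Lemma flat2_lt a x A B : (a < A)%N -> (x < B)%N -> (a * B + x < A * B)%N.
Proof. by move=> *; nia. Qed.

Lemma subn_div_mod j S : (j - j %/ S * S)%N = (j %% S)%N.
Proof. by rewrite {1}(divn_eq j S) addKn. Qed.

(** * Arrays of matrices in memory, and one level of encoding or decoding *)

Section Stacks.
Variable R : nzRingType.

Definition stack (M : nat -> word R) (a Q S : nat) (F : nat -> nat -> nat -> R) :=
  forall q x y, (q < Q)%N -> (x < S)%N -> (y < S)%N ->
    M (a + ((q * S + x) * S + y))%N = Elt (F q x y).

Lemma stack_keep M M' a Q S F k : (a + Q * S * S <= k)%N -> keep k M M' ->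
  stack M a Q S F -> stack M' a Q S F.
Proof.
move=> hk kM h q x y hq hx hy; rewrite kM ?h //.
apply: leq_trans hk; rewrite ltn_add2l; exact: flat3_lt.
Qed.

Variables (s0 p0 : nat).

(* One level of the recursion: matrix q is replaced by its p0 linear combinations
   of S x S blocks, numbered q * p0 + t; block e is in block row e / s0 and
   block column e mod s0. *)
Definition Enc (G : nat -> nat -> int) (S : nat) (F : nat -> nat -> nat -> R)
    (q x y : nat) : R :=
  \sum_(e < s0 * s0)
    F (q %/ p0)%N (e %/ s0 * S + x)%N (e %% s0 * S + y)%N *~ G (q %% p0)%N e.

(** The way back of one level: the entry lies in block number (x / S) s0 + y / S, which is a
    combination of the p0 products that matrix q gave rise to. *)
Definition Dec (G : nat -> nat -> int) (S : nat) (F : nat -> nat -> nat -> R)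
    (q x y : nat) : R :=
  \sum_(t < p0)
    F (q * p0 + t)%N (x %% S)%N (y %% S)%N *~ G (x %/ S * s0 + y %/ S)%N t.

End Stacks.

(* Registers: 0 = d, 1 = s, 3 = the padded size D = s * s0 ^ k, 4 = the distance
   Nm between consecutive arrays, 5 = the ring element 0, 6 = address of the
   current array, 7 and 8 = size and number of the matrices it holds, 9 and 10 =
   addresses of the encoded operands, 11 = loop bound, 12 = block size,
   20 = loop index, 21-28 = temporaries of loop bodies. *)
Definition split_idx : cmd :=
  Seq (Assign 22 (#20 / #12)) (Seq (Assign 23 (#20 - #22 * #12))
  (Seq (Assign 21 (#22 / #12)) (Assign 22 (#22 - #21 * #12)))).

(** In these names p stands for a parent matrix of size s0 S and c for a child of size S. [paddr]
    moves by e to another block of the parent, [caddr] by t to another child, while [pbase] and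
    [cbase] locate position (x, y) in block 0 and in child 0. *)
Definition paddr (s0 k e : nat) : expr :=
  (#k + (EC (e %/ s0) * (#12 * #7) + EC (e %% s0) * #12))%xp.

Definition caddr (k t : nat) : expr := (#k + EC t * (#12 * #12))%xp.

Definition pbase : expr := (#21 * (#7 * #7) + #22 * #7 + #23)%xp.
Definition cbase (p0 : nat) : expr :=
  (#21 * (EC p0 * (#12 * #12)) + #22 * #12 + #23)%xp.

Definition pass_enc (s0 p0 : nat) (G : nat -> nat -> int) : cmd :=
  Seq (Seq split_idx (Seq (Assign 24 (#6 + pbase)) (Assign 25 (#6 + #4 + cbase p0))))
      (seqs (rows G (s0 * s0) (paddr s0 24) (caddr 25) (iota 0 p0))).

Definition pass_dec (s0 p0 : nat) (G : nat -> nat -> int) : cmd :=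
  Seq (Seq split_idx (Seq (Assign 24 (#6 + cbase p0)) (Assign 25 (#6 + #4 + pbase))))
      (seqs (rows G p0 (caddr 24) (paddr s0 25) (iota 0 (s0 * s0)))).

Lemma noten_pass_enc s0 p0 G : noten (pass_enc s0 p0 G).
Proof. by rewrite /=; apply: all_seqs => //= [c1 c2 -> ->|] //; apply: all_rows. Qed.

Lemma noten_pass_dec s0 p0 G : noten (pass_dec s0 p0 G).
Proof. by rewrite /=; apply: all_seqs => //= [c1 c2 -> ->|] //; apply: all_rows. Qed.

Lemma cwf_pass_enc s0 p0 G : cwf (pass_enc s0 p0 G).
Proof. by rewrite /=; apply: all_seqs => //= [c1 c2 -> ->|] //; apply: all_rows. Qed.

Lemma cwf_pass_dec s0 p0 G : cwf (pass_dec s0 p0 G).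
Proof. by rewrite /=; apply: all_seqs => //= [c1 c2 -> ->|] //; apply: all_rows. Qed.

Section Passes.
Variables (R : nzRingType) (s l V s0 p0 : nat).
Hypothesis V2 : (2 <= V)%N.
Hypothesis s0_gt0 : (0 < s0)%N.
Hypothesis p0_gt0 : (0 < p0)%N.
Hypothesis s0V : (s0 <= V)%N.
Hypothesis p0V : (p0 <= V)%N.
Notation rg := (nat -> word R).
Notation mm := (nat -> word R).
Local Notation sl := (@sl R s V).
Local Notation ev := (@ev R V).
Local Notation wp := (@wp R s l V).

Lemma sl_seqE c1 c2 Q r M : sl (Seq c1 c2) Q r M = sl c1 (sl c2 Q) r M.
Proof. by []. Qed.

Lemma sl_split (Q : rg -> mm -> Prop) (r : rg) M j S :
  r 20%N = Int j -> r 12%N = Int S -> (j <= V)%N -> (S <= V)%N ->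
  (forall r', keep 21 r r' -> r' 21%N = Int (j %/ S %/ S)%N ->
     r' 22%N = Int (j %/ S %% S)%N -> r' 23%N = Int (j %% S)%N -> Q r' M) ->
  sl split_idx Q r M.
Proof.
move=> hj hS jV SV H.
have h1 : (j %/ S <= V)%N by apply: leq_trans (leq_div _ _) jV.
have h2 : (j %/ S %/ S <= V)%N by apply: leq_trans (leq_div _ _) h1.
do 5! rewrite /upd /= ?(hj, hS, jV, SV, h1, h2, leq_trunc_div, subn_div_mod).
apply: H => //.
by move=> i hi; rewrite !ltn_eqF //; apply: leq_trans hi _.
Qed.

Section OnePass.
Variables (r0 : rg) (M0 : mm) (cur Nm S Q : nat).
Hypotheses (h4 : r0 4%N = Int Nm) (h5 : r0 5%N = Elt 0) (h6 : r0 6%N = Int cur).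
Hypotheses (h7 : r0 7%N = Int (s0 * S)%N) (h12 : r0 12%N = Int S).
Hypothesis (h11 : r0 11%N = Int (Q * S * S)%N).
Hypothesis (S0 : (0 < S)%N).
Hypothesis (hc : (Q * p0 * S * S <= Nm)%N).
Hypothesis (hp : (Q * (s0 * S) * (s0 * S) <= Nm)%N).
Hypothesis (hV : (cur + 2 * Nm <= V)%N).

Let pidx j := (((j %/ S %/ S) * (s0 * S) + j %/ S %% S) * (s0 * S) + j %% S)%N.
Let cidx j := (((j %/ S %/ S) * p0 * S + j %/ S %% S) * S + j %% S)%N.

Lemma S_le : (S <= s0 * S)%N. Proof. by rewrite leq_pmull. Qed.

Lemma idx_q j : (j < Q * S * S)%N -> (j %/ S %/ S < Q)%N.
Proof. by move=> h; rewrite !ltn_divLR. Qed.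

Lemma pidx_lt j : (j < Q * S * S)%N -> (pidx j < Nm)%N.
Proof.
move=> h; apply: leq_trans hp; apply: flat3_lt; first exact: idx_q.
  by apply: leq_trans S_le; rewrite ltn_mod.
by apply: leq_trans S_le; rewrite ltn_mod.
Qed.

Lemma cidx_lt j : (j < Q * S * S)%N -> (cidx j < Nm)%N.
Proof.
move=> h; apply: leq_trans hc; apply: flat3_lt; rewrite ?ltn_mod //.
by rewrite ltn_mul2r p0_gt0 idx_q.
Qed.

Lemma N_le : (Q * S * S <= Nm)%N.
Proof. by apply: leq_trans hc; rewrite !leq_mul2r leq_pmulr // !orbT. Qed.

Lemma S_V : (0 < Q)%N -> (s0 * S <= V)%N.
Proof.
move=> Q0; apply: leq_trans hV; apply: (@leq_trans Nm); last by lia.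
apply: leq_trans hp; have : (0 < s0 * S)%N by rewrite muln_gt0 s0_gt0.
by rewrite -mulnA; move: (s0 * S)%N => A A0; rewrite mulnA leq_pmull // muln_gt0 Q0.
Qed.

(** The flag [base] selects the direction: true reads parents and writes children, as in encoding;
    false is decoding. *)
Lemma sl_base (j : nat) (r : rg) M base : (j < Q * S * S)%N -> keep 20 r0 r ->
   r 20%N = Int j ->
   sl (Seq split_idx (Seq (Assign 24 (#6 + (if base then pbase else cbase p0)))
         (Assign 25 (#6 + #4 + (if base then cbase p0 else pbase)))))
   (fun r' M' => [/\ M' = M, keep 21 r r',
      r' 24%N = Int (cur + (if base then pidx j else cidx j))%N &
      r' 25%N = Int (cur + Nm + (if base then cidx j else pidx j))%N]) r M.
Proof.
move=> jN kr h20.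
have Q0 : (0 < Q)%N by apply: leq_trans (idx_q jN).
have jV : (j <= V)%N by have := N_le; lia.
have SV : (S <= V)%N by apply: leq_trans S_le (S_V Q0).
have s0SV := S_V Q0.
have NV : (Nm <= V)%N by lia.
have cV : (cur <= V)%N by lia.
have h1 : (j %/ S <= V)%N by apply: leq_trans (leq_div _ _) jV.
have h2 : (j %/ S %/ S <= V)%N by apply: leq_trans (leq_div _ _) h1.
have h3 : (j %/ S %% S <= V)%N by apply: leq_trans (leq_mod _ _) h1.
have h3' : (j %% S <= V)%N by apply: leq_trans (leq_mod _ _) jV.
rewrite sl_seqE; apply: (sl_split (j := j) (S := S)) => //; first by rewrite kr.
move=> r1 k1 e21 e22 e23.
have g i : (i < 20)%N -> r1 i = r0 i by move=> hi; rewrite k1 ?kr // (leqW hi).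
have pE : (j %/ S %/ S * (s0 * S * (s0 * S)) + j %/ S %% S * (s0 * S) + j %% S = pidx j)%N.
  rewrite /pidx; lia.
have cE : (j %/ S %/ S * (p0 * (S * S)) + j %/ S %% S * S + j %% S = cidx j)%N.
  rewrite /cidx; lia.
have g4 := g 4%N isT; have g6 := g 6%N isT; have g7 := g 7%N isT.
have g12 := g 12%N isT; rewrite h4 in g4; rewrite h6 in g6; rewrite h7 in g7.
rewrite h12 in g12.
case: base;
  do 3! rewrite /upd /= ?(g4, g6, g7, g12, e21, e22, e23, cV, h2, h3, h3', s0SV, NV, p0V, SV, pE, cE).
  split=> //; move=> i hi; rewrite !ltn_eqF //; first exact: k1.
    by apply: leq_trans hi _.
  by apply: leq_trans hi _.
split=> //; move=> i hi; rewrite !ltn_eqF //; first exact: k1.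
  by apply: leq_trans hi _.
by apply: leq_trans hi _.
Qed.

Lemma ev_paddr (r : rg) k e a : r k = Int a -> r 7%N = Int (s0 * S)%N ->
  r 12%N = Int S -> (0 < Q)%N -> (a <= V)%N -> (e < s0 * s0)%N ->
  ev r (paddr s0 k e) = Some (a + (e %/ s0 * (S * (s0 * S)) + e %% s0 * S))%N.
Proof.
move=> hk e7 e12 Q0 aV he; have s0SV := S_V Q0.
have SV : (S <= V)%N by apply: leq_trans S_le s0SV.
have g1 : (e %/ s0 <= V)%N.
  by apply: leq_trans s0V; apply: ltnW; rewrite ltn_divLR.
have g2 : (e %% s0 <= V)%N.
  by apply: leq_trans s0V; apply: ltnW; rewrite ltn_mod.
by rewrite /= hk aV e7 e12 s0SV SV g1 g2.
Qed.

Lemma ev_caddr (r : rg) k t a : r k = Int a ->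
  r 12%N = Int S -> (0 < Q)%N -> (a <= V)%N -> (t < p0)%N ->
  ev r (caddr k t) = Some (a + t * (S * S))%N.
Proof.
move=> hk e12 Q0 aV ht; have s0SV := S_V Q0.
have SV : (S <= V)%N by apply: leq_trans S_le s0SV.
have g1 : (t <= V)%N by apply: leq_trans p0V; apply: ltnW.
by rewrite /= hk aV e12 SV g1.
Qed.

(** The loop index enumerates triples of a parent and a position inside an S x S block; one round
    reads that position in all s0^2 blocks and writes it in all p0 children. *)
Lemma wp_pass_enc (G : nat -> nat -> int) F : stack M0 cur Q (s0 * S) F ->
  wp (For 20 11 (pass_enc s0 p0 G)) (fun r' M' => [/\ keep 20 r0 r',
       keep (cur + Nm) M0 M' & stack M' (cur + Nm) (Q * p0) S (Enc s0 p0 G S F)])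
    r0 M0 (Q * S * S * (cost s l (pass_enc s0 p0 G) + 6) + 4).
Proof.
move=> hF.
pose ra j e := (cur + pidx j + (e %/ s0 * (S * (s0 * S)) + e %% s0 * S))%N.
pose wa j t := (cur + Nm + cidx j + t * (S * S))%N.
pose f j e := F (j %/ S %/ S)%N (e %/ s0 * S + j %/ S %% S)%N (e %% s0 * S + j %% S)%N.
(* The intended content as a function of the address alone, obtained by splitting the offset into
   matrix, row and column. *)
pose v a := let i := (a - (cur + Nm))%N in
   Enc s0 p0 G S F (i %/ S %/ S)%N (i %/ S %% S)%N (i %% S)%N.
have NV : (Q * S * S <= V)%N by have := N_le; lia.
have waE j t : wa j t = (cur + Nm + (((j %/ S %/ S * p0 + t) * S + j %/ S %% S) * S + j %% S))%N.
  by rewrite /wa /cidx; lia.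
apply: wp_mono (leqnn _); first apply: (@wp_pass R s l V V2 _ G p0 (s0 * s0)%N
   (paddr s0 24) (caddr 25) _ r0 M0 f ra wa v (cur + Nm)%N h11 NV h5).
- move=> j r M jN kr h20.
  have Q0 : (0 < Q)%N by apply: leq_trans (idx_q jN).
  apply: sl_mono (@sl_base j r M true jN kr h20) _ => r1 M1 [-> k1 e24 e25].
  split=> // [e he r2 k2|t ht r2 k2].
    apply: ev_paddr => //; rewrite ?k2 //; try by rewrite k1 // kr.
    by move: (pidx j) (pidx_lt jN) => z; clear -hV; lia.
  apply: ev_caddr => //; rewrite ?k2 //; try by rewrite k1 // kr.
  by move: (cidx j) (cidx_lt jN) => z; clear -hV; lia.
- move=> j e jN he.
  have hq := idx_q jN.
  have hx : (e %/ s0 * S + j %/ S %% S < s0 * S)%N.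
    by apply: flat2_lt; rewrite ?ltn_mod // ltn_divLR.
  have hy : (e %% s0 * S + j %% S < s0 * S)%N.
    by apply: flat2_lt; rewrite ltn_mod.
  have raE : ra j e = (cur + ((j %/ S %/ S * (s0 * S) + (e %/ s0 * S + j %/ S %% S)) * (s0 * S) + (e %% s0 * S + j %% S)))%N.
    by rewrite /ra /pidx; lia.
  rewrite raE; split; last exact: hF.
  by rewrite ltn_add2l; apply: leq_trans hp; apply: flat3_lt.
- by move=> j t _ _; rewrite /wa -addnA leq_addr.
- move=> j t jN ht; rewrite /v waE addKn.
  have [||-> -> ->] := @flat3K S (j %/ S %/ S * p0 + t) (j %/ S %% S) (j %% S);
    rewrite ?ltn_mod //.
  by rewrite /Enc divnMDl // (divn_small ht) addn0 modnMDl (modn_small ht).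
move=> r' M' [k1 k2 hw]; split=> // q x y hq hx hy.
have q1 : (q %/ p0 < Q)%N by rewrite ltn_divLR.
have t1 : (q %% p0 < p0)%N by rewrite ltn_mod.
have := hw ((q %/ p0 * S + x) * S + y)%N (q %% p0)%N (flat3_lt q1 hx hy) t1.
rewrite /v waE addKn; have [-> -> ->] := flat3K (q %/ p0) hx hy; rewrite -divn_eq.
by have [-> -> ->] := flat3K q hx hy.
Qed.

Lemma wp_pass_dec (G : nat -> nat -> int) F : stack M0 cur (Q * p0) S F ->
  wp (For 20 11 (pass_dec s0 p0 G)) (fun r' M' => [/\ keep 20 r0 r',
       keep (cur + Nm) M0 M' & stack M' (cur + Nm) Q (s0 * S) (Dec s0 p0 G S F)])
    r0 M0 (Q * S * S * (cost s l (pass_dec s0 p0 G) + 6) + 4).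
Proof.
move=> hF.
pose wa j e := (cur + Nm + pidx j + (e %/ s0 * (S * (s0 * S)) + e %% s0 * S))%N.
pose ra j t := (cur + cidx j + t * (S * S))%N.
pose f j t := F (j %/ S %/ S * p0 + t)%N (j %/ S %% S)%N (j %% S)%N.
pose v a := let i := (a - (cur + Nm))%N in
   Dec s0 p0 G S F (i %/ (s0 * S) %/ (s0 * S))%N (i %/ (s0 * S) %% (s0 * S))%N (i %% (s0 * S))%N.
have NV : (Q * S * S <= V)%N by have := N_le; lia.
have raE j t : ra j t = (cur + (((j %/ S %/ S * p0 + t) * S + j %/ S %% S) * S + j %% S))%N.
  by rewrite /ra /cidx; lia.
have waE j e : wa j e = (cur + Nm + ((j %/ S %/ S * (s0 * S) + (e %/ s0 * S + j %/ S %% S)) * (s0 * S) + (e %% s0 * S + j %% S)))%N.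
  by rewrite /wa /pidx; lia.
have hx j e : (e < s0 * s0)%N -> (e %/ s0 * S + j %/ S %% S < s0 * S)%N.
  by move=> he; apply: flat2_lt; rewrite ?ltn_mod // ltn_divLR.
have hy j e : (e %% s0 * S + j %% S < s0 * S)%N.
  by apply: flat2_lt; rewrite ltn_mod.
apply: wp_mono (leqnn _); first apply: (@wp_pass R s l V V2 _ G (s0 * s0)%N p0
   (caddr 24) (paddr s0 25) _ r0 M0 f ra wa v (cur + Nm)%N h11 NV h5).
- move=> j r M jN kr h20.
  have Q0 : (0 < Q)%N by apply: leq_trans (idx_q jN).
  apply: sl_mono (@sl_base j r M false jN kr h20) _ => r1 M1 [-> k1 e24 e25].
  split=> // [t ht r2 k2|e he r2 k2].
    apply: ev_caddr => //; rewrite ?k2 //; try by rewrite k1 // kr.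
    by move: (cidx j) (cidx_lt jN) => z; clear -hV; lia.
  apply: ev_paddr => //; rewrite ?k2 //; try by rewrite k1 // kr.
  by move: (pidx j) (pidx_lt jN) => z; clear -hV; lia.
- move=> j t jN ht.
  have hq := idx_q jN.
  have hq' : (j %/ S %/ S * p0 + t < Q * p0)%N by exact: flat2_lt.
  rewrite raE; split; last by apply: hF => //; rewrite ltn_mod.
  by rewrite ltn_add2l; apply: leq_trans hc; apply: flat3_lt; rewrite // ltn_mod.
- by move=> j t _ _; rewrite /wa -addnA leq_addr.
- move=> j e jN he; rewrite /v waE addKn.
  have [-> -> ->] := flat3K (j %/ S %/ S) (hx j e he) (hy j e).
  rewrite /Dec !divnMDl // !modnMDl !modn_mod !(divn_small (ltn_pmod _ S0)) !addn0.
  by rewrite -divn_eq.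
move=> r' M' [k1 k2 hw]; split=> // q x y hq hx' hy'.
have x1 : (x %/ S < s0)%N by rewrite ltn_divLR.
have y1 : (y %/ S < s0)%N by rewrite ltn_divLR.
have x2 : (x %% S < S)%N by rewrite ltn_mod.
have y2 : (y %% S < S)%N by rewrite ltn_mod.
(* A parent entry is produced in the round of its position inside its block, as the output numbered
   by that block. *)
have he : (x %/ S * s0 + y %/ S < s0 * s0)%N by exact: flat2_lt.
have := hw ((q * S + x %% S) * S + y %% S)%N (x %/ S * s0 + y %/ S)%N (flat3_lt hq x2 y2) he.
rewrite /v waE addKn; have [-> -> ->] := flat3K q x2 y2.
rewrite divnMDl // (divn_small y1) addn0 modnMDl (modn_small y1) -!divn_eq.
by have [-> -> ->] := flat3K q hx' hy'.
Qed.

End OnePass.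
End Passes.

(** * Iterated encoding and decoding, and the cost of the encoding loop *)

Section Families.
Variables (R : nzRingType) (s s0 p0 : nat).

(** Encoding splits the largest blocks first, so the recursion continues on the encoded family.
    [decs] runs through the levels in the opposite order and handles the largest blocks last. *)
Fixpoint encs (G : nat -> nat -> int) (j : nat) (F : nat -> nat -> nat -> R) :=
  if j is j'.+1 then encs G j' (Enc s0 p0 G (s * s0 ^ j') F) else F.

Fixpoint decs (G : nat -> nat -> int) (j : nat) (F : nat -> nat -> nat -> R) :=
  if j is j'.+1 then Dec s0 p0 G (s * s0 ^ j') (decs G j' F) else F.

Definition mulF (S : nat) (F H : nat -> nat -> nat -> R) (q x y : nat) : R :=
  \sum_(z < S) F q x z * H q z y.

End Families.

Definition enc_step (s0 p0 : nat) (G : nat -> nat -> int) : cmd :=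
  Seq (Seq (Assign 12 (#7 / EC s0)) (Assign 11 (#8 * #12 * #12)))
  (Seq (For 20 11 (pass_enc s0 p0 G))
  (Seq (Assign 6 (#6 + #4)) (Seq (Assign 7 (#12)) (Assign 8 (#8 * EC p0))))).

Definition enc_loop s0 p0 G : cmd := While 1 7 (enc_step s0 p0 G).

Definition dec_step (s0 p0 : nat) (G : nat -> nat -> int) : cmd :=
  Seq (Seq (Assign 12 (#7)) (Seq (Assign 7 (EC s0 * #7)) (Seq (Assign 8 (#8 / EC p0))
       (Assign 11 (#8 * #12 * #12)))))
  (Seq (For 20 11 (pass_dec s0 p0 G)) (Assign 6 (#6 + #4))).

Definition dec_loop s0 p0 G : cmd := While 7 3 (dec_step s0 p0 G).

Definition prod_loop : cmd :=
  For 20 8 (Ten (#9 + #20 * (#1 * #1)) (#10 + #20 * (#1 * #1)) (#6 + #20 * (#1 * #1))).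

(* The padding is branch-free: #24 is 1 inside the d x d corner and 0 outside,
   where the element 0 kept at address 2 d^2 is read instead. *)
Definition pad_loop (src : expr) : cmd :=
  Seq (Assign 11 (#3 * #3)) (For 20 11
    (Seq (Assign 22 (#20 / #3)) (Seq (Assign 23 (#20 - #22 * #3))
    (Seq (Assign 24 (EC 1 / (#22 / #0 + #23 / #0 + EC 1)))
    (Seq (Ld 28 (#24 * (src + #22 * #0 + #23) + (EC 1 - #24) * (EC 2 * (#0 * #0))))
         (St (#6 + #20) 28)))))).

Definition out_loop : cmd :=
  Seq (Assign 11 (#0 * #0)) (For 20 11
    (Seq (Assign 22 (#20 / #0)) (Seq (Assign 23 (#20 - #22 * #0))
    (Seq (Ld 28 (#6 + #22 * #3 + #23)) (St (EC 2 * (#0 * #0) + #20) 28))))).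

(** The telescoping step, with a = p0^j and b = n0^j: p a - n0 b exceeds p (a - b) by (p - n0) b,
    which is at least b, the size of the current level. The strict inequality between rank and n0
    enters here. *)
Lemma level_time c a b Q m n0 p : (b <= a)%N -> (n0 < p)%N ->
  (Q * (b * m) * c + c * (Q * p * m * (a - b)) <= c * (Q * m * (p * a - n0 * b)))%N.
Proof.
move=> ba np.
have -> : (Q * (b * m) * c + c * (Q * p * m * (a - b)) =
   c * (Q * m * (b + p * (a - b))))%N by ring.
rewrite leq_mul2l leq_mul2l; apply/orP; right; apply/orP; right.
rewrite mulnBr; have : (p * b <= p * a)%N by rewrite leq_mul2l ba orbT.
have : (b + n0 * b <= p * b)%N by rewrite -mulSn leq_mul2r np orbT.
by lia.
Qed.

Section Loops.
Variables (R : nzRingType) (s l V s0 p0 : nat).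
Hypothesis V2 : (2 <= V)%N.
Hypothesis s0_gt1 : (1 < s0)%N.
Hypothesis p0_gt : (s0 * s0 < p0)%N.
Hypothesis s0V : (s0 <= V)%N.
Hypothesis p0V : (p0 <= V)%N.
Hypothesis s_gt0 : (0 < s)%N.
Notation rg := (nat -> word R).
Notation mm := (nat -> word R).
Local Notation wp := (@wp R s l V).

Let s0_gt0 : (0 < s0)%N. Proof. exact: ltnW. Qed.
Let p0_gt0 : (0 < p0)%N. Proof. exact: leq_ltn_trans p0_gt. Qed.

Lemma pow_le j : ((s0 * s0) ^ j <= p0 ^ j)%N.
Proof. by case: j => // j; rewrite leq_exp2r // ltnW. Qed.

Lemma sqS j : (s * s0 ^ j * (s * s0 ^ j) = (s0 * s0) ^ j * (s * s))%N.
Proof. by rewrite expnMn; ring. Qed.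

(** 32 = 6 + 26: the loop overhead of each round, and the overhead of a whole level, which is
    charged to its rounds since there is at least one. The same sum gives [dec_const]. *)
Definition enc_const G : nat := cost 0 0 (pass_enc s0 p0 G) + 32.
Definition dec_const G : nat := cost 0 0 (pass_dec s0 p0 G) + 32.

(** Induction on the number j of levels left, for any number Q of matrices. Every level moves to the
    next slot of Nm cells, so j + 1 slots suffice. *)
Lemma wp_enc_loop G j (r : rg) (M : mm) cur Nm Q F :
  r 1%N = Int s -> r 4%N = Int Nm -> r 5%N = Elt 0 -> r 6%N = Int cur ->
  r 7%N = Int (s * s0 ^ j)%N -> r 8%N = Int Q -> (0 < Q)%N ->
  (Q * p0 ^ j * (s * s) <= Nm)%N -> (cur + j.+1 * Nm <= V)%N ->
  stack M cur Q (s * s0 ^ j) F ->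
  wp (enc_loop s0 p0 G) (fun r' M' =>
    [/\ keep 6 r r', r' 9%N = r 9%N & r' 10%N = r 10%N] /\
    [/\ r' 6%N = Int (cur + j * Nm)%N, r' 7%N = Int s, r' 8%N = Int (Q * p0 ^ j)%N,
        keep (cur + Nm) M M' &
        stack M' (cur + j * Nm) (Q * p0 ^ j) s (encs s s0 p0 G j F)]) r M
    (enc_const G * (Q * (s * s) * (p0 ^ j - (s0 * s0) ^ j)) + 2).
Proof.
elim: j r M cur Q F => [|j IH] r M cur Q F h1 h4 h5 h6 h7 h8 Q0 hN hV hF.
  rewrite expn0 muln1 in h7 hF *.
  rewrite !expn0 subnn !muln0 add0n; apply: (@wp_whileF _ _ _ _ _ _ _ _ _ _ _ _ h1 h7 (leqnn _)).
  by rewrite mul0n addn0 ?muln1; split; split.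
set S := (s * s0 ^ j)%N.
have SE : (s * s0 ^ j.+1 = s0 * S)%N by rewrite expnS /S; ring.
rewrite SE in h7 hF.
have S_gt0 : (0 < S)%N by rewrite muln_gt0 s_gt0 expn_gt0 s0_gt0.
have m_gt0 : (0 < s * s)%N by rewrite muln_gt0 s_gt0.
have hNle : (Nm <= V)%N by nia.
have hc : (Q * p0 * S * S <= Nm)%N.
  apply: leq_trans hN; rewrite -(mulnA _ S) sqS expnS !mulnA.
  by rewrite !leq_mul // pow_le.
have hp : (Q * (s0 * S) * (s0 * S) <= Nm)%N.
  apply: leq_trans hN; rewrite -SE -(mulnA Q) sqS !mulnA.
  by rewrite !leq_mul // pow_le.
have hpass : (Q * S * S <= Nm)%N.
  by apply: leq_trans hc; rewrite -!(mulnA _ S) leq_mul2r leq_pmulr // orbT.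
have SV : (s0 * S <= V)%N.
  apply: leq_trans hNle; apply: leq_trans hp.
  by rewrite leq_pmull // muln_gt0 Q0 muln_gt0 s0_gt0.
have SV' : (S <= V)%N by apply: leq_trans SV; rewrite leq_pmull.
have QV : (Q <= V)%N.
  apply: leq_trans hNle; apply: leq_trans hpass.
  by rewrite -mulnA leq_pmulr // muln_gt0 S_gt0.
have QSV : (Q * S * S <= V)%N by apply: leq_trans hNle.
have Vcur : (cur <= V)%N by apply: leq_trans hV; rewrite leq_addr.
have s_lt : (s < s0 * S)%N.
  by rewrite -SE ltn_Pmulr // -[1%N](exp1n j.+1) ltn_exp2r.
apply: (@wp_le _ _ _ _ _ _ _ _ (10 + (Q * S * S * (cost s l (pass_enc s0 p0 G) + 6) + 4 + 10) +
    (enc_const G * (Q * p0 * (s * s) * (p0 ^ j - (s0 * s0) ^ j)) + 2) + 2)%N); last 1 first.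
- have hl := @level_time (enc_const G) (p0 ^ j) ((s0 * s0) ^ j) Q (s * s) (s0 * s0) p0 (pow_le j) p0_gt.
  rewrite !expnS; rewrite -(leq_add2r 2) in hl; apply: leq_trans hl.
  rewrite -sqS -/S cost_noten ?noten_pass_enc // -(mulnA Q).
  have : enc_const G = (cost 0 0 (pass_enc s0 p0 G) + 32)%N by [].
  have : (0 < Q * (S * S))%N by rewrite muln_gt0 Q0 /= muln_gt0 S_gt0.
  move: (Q * (S * S))%N (cost 0 0 _) (enc_const G * _)%N => A B C A0 ->; nia.
- apply: (wp_whileT h1 h7 s_lt); apply: wp_slseq.
  do 4! rewrite /upd /= ?(h7, h8, s0V, SV, SV', QV, mulKn _ s0_gt0).
  pose r1 : rg := upd (upd r 12 (Int S)) 11 (Int (Q * S * S)%N).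
  apply: wp_seq; apply: wp_mono (leqnn _).
    by apply: (@wp_pass_enc R s l V s0 p0 V2 s0_gt0 p0_gt0 s0V p0V r1 M cur Nm S Q
      h4 h5 h6 h7 erefl erefl S_gt0 hc hp _ G F hF); nia.
  move=> r2 M2 [k2 kM2 hF2]; apply: wp_sl.
  have g i : (i < 20)%N -> r2 i = r1 i by exact: k2.
  have g4 : r2 4%N = Int Nm by rewrite g.
  have g6 : r2 6%N = Int cur by rewrite g.
  have g12 : r2 12%N = Int S by rewrite g.
  have g8 : r2 8%N = Int Q by rewrite g.
  do 4! rewrite /upd /= ?(g4, g6, g8, g12, Vcur, hNle, SV', QV, p0V).
  apply: wp_mono (leqnn _).
    apply: (IH _ M2 (cur + Nm)%N (Q * p0)%N (Enc s0 p0 G S F)) => //=.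
    + by rewrite g.
    + by rewrite g.
    + by rewrite muln_gt0 Q0.
    + by rewrite -(mulnA Q) -expnS.
    + by rewrite -addnA -mulSn.
  move=> r3 M3 [[k3 e9 e10] [f6 f7 f8 kM3 hF3]].
  rewrite -mulnA -expnS in f8 hF3.
  rewrite -addnA -mulSn in f6 hF3.
  split; split=> //.
  + move=> i hi; rewrite k3 // !ltn_eqF ?g //;
      rewrite ?(leq_trans hi) // /r1 /upd !ltn_eqF //; exact: leq_trans hi _.
  + by rewrite e9 /= g.
  + by rewrite e10 /= g.
  + by apply: keep_trans kM2 _; apply: keepW kM3; rewrite leq_addr.
Qed.

End Loops.

Section Store.
Variable R : nzRingType.

Lemma store_mx_in (M : nat -> word R) a h w (X : 'M[R]_(h, w)) (i : 'I_h) (j : 'I_w) :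
  store_mx M a X (a + i * w + j)%N = Elt (X i j).
Proof.
rewrite /store_mx; case: pickP => [[i' j'] /= /eqP E|/(_ (i, j))]; last by rewrite eqxx.
have w0 : (0 < w)%N by apply: leq_ltn_trans (ltn_ord j).
have E' : (i * w + j = i' * w + j')%N by lia.
have ji : j = j'.
  apply: val_inj; move/(congr1 (fun z => z %% w)%N): E'.
  by rewrite !modnMDl !modn_small.
have ii : i = i'.
  apply: val_inj; move/(congr1 (fun z => z %/ w)%N): E'.
  by rewrite !divnMDl // !divn_small // !addn0.
by rewrite ii ji.
Qed.

Lemma store_mx_out (M : nat -> word R) a h w (X : 'M[R]_(h, w)) x :
  (x < a)%N || (a + h * w <= x)%N -> store_mx M a X x = M x.
Proof.
move=> hx; rewrite /store_mx; case: pickP => // -[i j] /= /eqP E.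
have := flat2_lt (ltn_ord i) (ltn_ord j); move: (i * w)%N (h * w)%N E hx => A B; lia.
Qed.

End Store.

(** The mirror image for decoding, where the levels shrink: with a = p0^j, the claim reduces to a +
    n0 a <= p a. *)
Lemma level_time_dec c a b A n0 p : (b <= a)%N -> (n0 < p)%N ->
  (a * A * c + c * (n0 * A * (a - b)) <= c * (A * (p * a - n0 * b)))%N.
Proof.
move=> ba np.
have -> : (a * A * c + c * (n0 * A * (a - b)) = c * (A * (a + n0 * (a - b))))%N by ring.
rewrite leq_mul2l leq_mul2l; apply/orP; right; apply/orP; right.
rewrite mulnBr; have : (n0 * b <= n0 * a)%N by rewrite leq_mul2l ba orbT.
have : (a + n0 * a <= p * a)%N by rewrite -mulSn leq_mul2r np orbT.
by lia.
Qed.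

(** * The decoding loop *)

Section DecodeLoop.
Variables (R : nzRingType) (s l V s0 p0 : nat).
Hypothesis V2 : (2 <= V)%N.
Hypothesis s0_gt1 : (1 < s0)%N.
Hypothesis p0_gt : (s0 * s0 < p0)%N.
Hypothesis s0V : (s0 <= V)%N.
Hypothesis p0V : (p0 <= V)%N.
Hypothesis s_gt0 : (0 < s)%N.
Notation rg := (nat -> word R).
Notation mm := (nat -> word R).
Local Notation wp := (@wp R s l V).

Let s0_gt0 : (0 < s0)%N. Proof. exact: ltnW. Qed.
Let p0_gt0 : (0 < p0)%N. Proof. exact: leq_ltn_trans p0_gt. Qed.

(** Here i levels have been decoded and j remain; the induction trades j for i, keeping i + j and
    hence the final size fixed. *)
Lemma wp_dec_loop G i j (r : rg) (M : mm) cur Nm W :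
  r 3%N = Int (s * s0 ^ (i + j))%N -> r 4%N = Int Nm -> r 5%N = Elt 0 ->
  r 6%N = Int cur -> r 7%N = Int (s * s0 ^ i)%N -> r 8%N = Int (p0 ^ j)%N ->
  (p0 ^ (i + j) * (s * s) <= Nm)%N -> (cur + j.+1 * Nm <= V)%N ->
  stack M cur (p0 ^ j) (s * s0 ^ i) (decs s s0 p0 G i W) ->
  wp (dec_loop s0 p0 G) (fun r' M' =>
    [/\ keep 6 r r', r' 6%N = Int (cur + j * Nm)%N, keep (cur + Nm) M M' &
        stack M' (cur + j * Nm) 1 (s * s0 ^ (i + j)) (decs s s0 p0 G (i + j) W)]) r M
    (dec_const s0 p0 G * ((s0 * s0) ^ i * (s * s) * (p0 ^ j - (s0 * s0) ^ j)) + 2).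
Proof.
elim: j i r M cur => [|j IH] i r M cur h3 h4 h5 h6 h7 h8 hN hV hF.
  rewrite addn0 in h3 hF *.
  rewrite !expn0 subnn !muln0 add0n; apply: (@wp_whileF _ _ _ _ _ _ _ _ _ _ _ _ h7 h3 (leqnn _)).
  by rewrite mul0n addn0; split.
set S := (s * s0 ^ i)%N.
have SE : (s * s0 ^ i.+1 = s0 * S)%N by rewrite expnS /S; ring.
set Q := (p0 ^ j)%N.
have Q0 : (0 < Q)%N by rewrite expn_gt0 p0_gt0.
have S_gt0 : (0 < S)%N by rewrite muln_gt0 s_gt0 expn_gt0 s0_gt0.
have hNle : (Nm <= V)%N by nia.
have powi n : ((s0 * s0) ^ n <= p0 ^ n)%N by exact: pow_le.
have hc : (Q * p0 * S * S <= Nm)%N.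
  apply: leq_trans hN; rewrite -(mulnA _ S) sqS addnS -addSn addnC expnD expnS.
  rewrite [(p0 ^ j * _)%N]mulnA !mulnA.
  by rewrite !leq_mul.
have hp : (Q * (s0 * S) * (s0 * S) <= Nm)%N.
  apply: leq_trans hN; rewrite -SE -(mulnA Q) sqS addnS -addSn addnC expnD !mulnA.
  by rewrite !leq_mul // powi.
have hpass : (Q * S * S <= Nm)%N.
  by apply: leq_trans hc; rewrite -!(mulnA _ S) leq_mul2r leq_pmulr // orbT.
have SV : (s0 * S <= V)%N.
  apply: leq_trans hNle; apply: leq_trans hp.
  by rewrite leq_pmull // muln_gt0 Q0 muln_gt0 s0_gt0.
have SV' : (S <= V)%N by apply: leq_trans SV; rewrite leq_pmull.
have QpV : (Q * p0 <= V)%N.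
  apply: leq_trans hNle; apply: leq_trans hc.
  by rewrite -mulnA leq_pmulr // muln_gt0 S_gt0.
have QV : (Q <= V)%N by apply: leq_trans QpV; rewrite leq_pmulr.
have Vcur : (cur <= V)%N by apply: leq_trans hV; rewrite leq_addr.
have S_lt : (S < s * s0 ^ (i + j.+1))%N.
  by rewrite ltn_pmul2l // ltn_exp2l // addnS ltnS leq_addr.
have h8' : r 8%N = Int (Q * p0)%N by rewrite h8 expnS mulnC.
apply: (@wp_le _ _ _ _ _ _ _ _ (16 + (Q * S * S * (cost s l (pass_dec s0 p0 G) + 6) + 4 + 4) +
    (dec_const s0 p0 G * ((s0 * s0) ^ i.+1 * (s * s) * (p0 ^ j - (s0 * s0) ^ j)) + 2) + 2)%N); last 1 first.
- have hl := @level_time_dec (dec_const s0 p0 G) (p0 ^ j) ((s0 * s0) ^ j)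
     ((s0 * s0) ^ i * (s * s)) (s0 * s0) p0 (powi j) p0_gt.
  rewrite !expnS; rewrite -(leq_add2r 2) in hl; apply: leq_trans hl.
  rewrite -(mulnA (s0 * s0)) -sqS -/S -/Q cost_noten ?noten_pass_dec // -(mulnA Q).
  have : dec_const s0 p0 G = (cost 0 0 (pass_dec s0 p0 G) + 32)%N by [].
  have : (0 < Q * (S * S))%N by rewrite muln_gt0 Q0 /= muln_gt0 S_gt0.
  move: (Q * (S * S))%N (cost 0 0 _) (dec_const s0 p0 G * _)%N => A B C A0 ->; nia.
- apply: (wp_whileT h7 h3 S_lt); apply: wp_slseq.
  do 5! rewrite /upd /= ?(h7, h8', s0V, SV, SV', QV, QpV, p0V, mulnK _ p0_gt0).
  pose r1 : rg := upd (upd (upd (upd r 12 (Int S)) 7 (Int (s0 * S)%N)) 8 (Int Q)) 11 (Int (Q * S * S)%N).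
  apply: wp_seq; apply: wp_mono (leqnn _).
    apply: (@wp_pass_dec R s l V s0 p0 V2 s0_gt0 p0_gt0 s0V p0V r1 M cur Nm S Q
      h4 h5 h6 erefl erefl erefl S_gt0 hc hp _ G (decs s s0 p0 G i W)); first by nia.
    by move: hF; rewrite expnS mulnC.
  move=> r2 M2 [k2 kM2 hF2]; apply: wp_sl.
  have g n : (n < 20)%N -> r2 n = r1 n by exact: k2.
  have g4 : r2 4%N = Int Nm by rewrite g.
  have g6 : r2 6%N = Int cur by rewrite g.
  do 2! rewrite /upd /= ?(g4, g6, Vcur, hNle).
  apply: wp_mono (leqnn _).
    apply: (IH i.+1 _ M2 (cur + Nm)%N) => //=.
    + by rewrite g // addSnnS.
    + by rewrite g.
    + by rewrite g // SE.
    + by rewrite g.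
    + by rewrite addSnnS.
    + by rewrite -addnA -mulSn.
    + by rewrite SE.
  move=> r3 M3 [k3 f6 kM3 hF3].
  rewrite -addnA -mulSn addSnnS in f6 hF3.
  split=> //.
  + move=> n hn; rewrite k3 // !ltn_eqF ?g //;
      rewrite ?(leq_trans hn) // /r1 /upd !ltn_eqF //; exact: leq_trans hn _.
  + by apply: keep_trans kM2 _; apply: keepW kM3; rewrite leq_addr.
Qed.


End DecodeLoop.

(** * Tensor products of the leaves, padding and output *)

Section FlatLoops.
Variables (R : nzRingType) (s l V : nat).
Hypothesis V2 : (2 <= V)%N.
Notation rg := (nat -> word R).
Notation mm := (nat -> word R).
Local Notation ev := (@ev R V).
Local Notation wp := (@wp R s l V).

Lemma holds_mx_stack (M : mm) a Q F q : (q < Q)%N -> stack M a Q s F ->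
  holds_mx M (a + q * (s * s)) s s.
Proof.
move=> hq h; apply/forallP => i; apply/forallP => j.
have -> : (a + q * (s * s) + i * s + j = a + ((q * s + i) * s + j))%N by lia.
by rewrite h.
Qed.

(** The 27 is 21 for the three addresses, at 7 instructions each, plus 6 for the loop. *)
Lemma wp_prod (r : rg) (M : mm) ua ub cur Nm Q F H :
  (0 < s)%N -> r 1%N = Int s -> r 8%N = Int Q -> r 9%N = Int ua -> r 10%N = Int ub ->
  r 6%N = Int cur -> (s <= V)%N -> (Q * (s * s) <= Nm)%N ->
  (ua + Nm <= cur)%N -> (ub + Nm <= cur)%N -> (cur + Nm <= V)%N ->
  stack M ua Q s F -> stack M ub Q s H ->
  wp prod_loop (fun r' M' => [/\ keep 20 r r', keep cur M M' &
     stack M' cur Q s (mulF s F H)]) r M (Q * (s * s + l + 27) + 4).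
Proof.
move=> s_gt0 h1 h8 h9 h10 h6 sV hQ hua hub hV hF hH.
pose I j (M' : mm) := keep cur M M' /\ forall q x y, (q < j)%N -> (x < s)%N -> (y < s)%N ->
  M' (cur + ((q * s + x) * s + y))%N = Elt (mulF s F H q x y).
have ss : (0 < s * s)%N by rewrite muln_gt0 s_gt0.
have QV : (Q <= V)%N by nia.
apply: (@wp_mono _ _ _ _ _ (fun r' M' => keep 20 r r' /\ I Q M') _ r M (Q * (21 + (s * s + l) + 6) + 4)%N).
- apply: wp_for => //.
  move=> j r1 M1 jQ k1 r1j [kM1 I1]; apply: wp_sl.
  have jss : (j * (s * s) + s * s <= Nm)%N.
    by apply: leq_trans hQ; rewrite addnC -mulSn leq_mul2r jQ orbT.
  have g1 : r1 1%N = Int s by rewrite k1.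
  have g6 : r1 6%N = Int cur by rewrite k1.
  have g9 : r1 9%N = Int ua by rewrite k1.
  have g10 : r1 10%N = Int ub by rewrite k1.
  have jV : (j <= V)%N by apply: leq_trans QV; apply: ltnW.
  have cV : (cur <= V)%N by lia.
  have uaV : (ua <= V)%N by lia.
  have ubV : (ub <= V)%N by lia.
  have hF1 : stack M1 ua Q s F.
    by apply: stack_keep kM1 hF; rewrite -mulnA; lia.
  have hH1 : stack M1 ub Q s H.
    by apply: stack_keep kM1 hH; rewrite -mulnA; lia.
  rewrite /= g1 g6 g9 g10 r1j sV jV cV uaV ubV /=; split=> //.
  + by apply/and3P; split; lia.
  + exact: holds_mx_stack hF1.
  + exact: holds_mx_stack hH1.
  split=> //; split.
  + move=> a ha; rewrite store_mx_out ?kM1 //; lia.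
  + move=> q x y; rewrite ltnS leq_eqVlt => /orP[/eqP -> hx hy|lt hx hy].
      have := store_mx_in M1 (cur + j * (s * s)) (load_mx M1 (ua + j * (s * s)) s s *m
        load_mx M1 (ub + j * (s * s)) s s) (Ordinal hx) (Ordinal hy).
      rewrite /= (_ : cur + j * (s * s) + x * s + y = cur + ((j * s + x) * s + y))%N; last by lia.
      move=> ->; congr Elt; rewrite mxE /mulF; apply: eq_bigr => z _; rewrite !mxE /=.
      rewrite (_ : ua + j * (s * s) + x * s + z = ua + ((j * s + x) * s + z))%N; last by lia.
      rewrite (_ : ub + j * (s * s) + z * s + y = ub + ((j * s + z) * s + y))%N; last by lia.
      by rewrite hF1 // hH1.
    rewrite store_mx_out; first exact: I1.
    apply/orP; left; rewrite ltn_add2l.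
    by apply: leq_trans (flat3_lt lt hx hy) _; rewrite mulnA.
- by move=> r' M' [k [kM h]]; split.
- by apply: eq_leq; lia.
Qed.

Lemma wp_pad src sa d D cur (A : nat -> nat -> R) (r : rg) (M : mm) :
  (forall r' : rg, r' 0%N = Int d -> ev r' src = Some sa) -> (ecost src <= 3)%N ->
  r 0%N = Int d -> r 3%N = Int D -> r 6%N = Int cur -> (0 < d)%N -> (d <= D)%N ->
  (sa + d * d <= cur)%N -> (2 * (d * d) < cur)%N -> (cur + D * D <= V)%N ->
  (forall x y, (x < d)%N -> (y < d)%N -> M (sa + (x * d + y))%N = Elt (A x y)) ->
  M (2 * (d * d))%N = Elt 0 ->
  wp (pad_loop src) (fun r' M' => [/\ forall i, (i < 11)%N -> r' i = r i,
     keep cur M M' & stack M' cur 1 D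
       (fun _ x y => if (x < d)%N && (y < d)%N then A x y else 0)])
   r M (D * D * 100 + 10).
Proof.
move=> hsrc csrc h0 h3 h6 d_gt0 dD hsa h2d hV hA hz.
have D0 : (0 < D)%N by apply: leq_trans dD.
have DV : (D <= V)%N by nia.
have dV : (d <= V)%N by lia.
have DDV : (D * D <= V)%N by lia.
have cV : (cur <= V)%N by lia.
have V1 : (1 <= V)%N by lia.
pose P x y : R := if (x < d)%N && (y < d)%N then A x y else 0.
pose I j (M' : mm) := keep cur M M' /\
   forall i, (i < j)%N -> M' (cur + i)%N = Elt (P (i %/ D)%N (i %% D)%N).
rewrite /pad_loop; set body := (X in For 20 11 X).
have bc : (cost s l body <= 80)%N by rewrite /body /=; lia.
apply: (@wp_le _ _ _ _ _ _ _ _ (4 + (D * D * (80 + 6) + 4))%N); last by nia.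
apply: wp_slseq; do 2! rewrite /upd /= ?(h3, DV).
pose r1 : rg := upd r 11 (Int (D * D)%N).
apply: (@wp_mono _ _ _ _ _ (fun r' M' => keep 20 r1 r' /\ I (D * D)%N M') _ _ _ (D * D * (80 + 6) + 4)%N) => //.
  apply: wp_for => //.
  move=> j r2 M2 jN k2 r2j [kM2 I2]; apply: (@wp_le _ _ _ _ _ _ _ _ (cost s l body)) bc.
  apply: wp_sl.
  have jV : (j <= V)%N by lia.
  have g0 : r2 0%N = Int d by rewrite k2.
  have g3 : r2 3%N = Int D by rewrite k2.
  have g6 : r2 6%N = Int cur by rewrite k2.
  have q1 : (j %/ D <= V)%N by apply: leq_trans (leq_div _ _) jV.
  have q2 : (j %% D <= V)%N by apply: leq_trans (leq_mod _ _) jV.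
  (* The denominator is 1 exactly when row and column are both below d; otherwise it is at least 2
     and g = 0. *)
  set g := (1 %/ (j %/ D %/ d + j %% D %/ d + 1))%N.
  have gle : (g <= 1)%N by rewrite /g leq_div.
  have gV : (g <= V)%N by apply: leq_trans V1.
  rewrite /body.
  do 3! rewrite /upd /= ?(r2j, g0, g3, g6, jV, dV, DV, q1, q2, leq_trunc_div, subn_div_mod, V1, V2).
  rewrite -/g.
  do 3! rewrite /upd /= ?(r2j, g0, g3, g6, jV, dV, DV, q1, q2, V1, V2, gV, gle, cV).
  rewrite hsrc //=.
  do 3! rewrite /upd /= ?(r2j, g0, g3, g6, jV, dV, DV, q1, q2, V1, V2, gV, gle, cV).
  have rd : M2 (g * (sa + j %/ D * d + j %% D) + (1 - g) * (2 * (d * d)))%N =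
     Elt (P (j %/ D)%N (j %% D)%N).
    rewrite /P; case: ifP => [/andP[hx hy]|hxy].
      have -> : g = 1%N by rewrite /g (divn_small hx) (divn_small hy).
      rewrite mul1n subnn mul0n addn0 -addnA kM2 ?hA //.
      apply: leq_trans hsa; rewrite ltn_add2l; exact: flat2_lt.
    have -> : g = 0%N.
      have E z : (z %/ d == 0)%N = (z < d)%N.
        by rewrite -leqn0 -ltnS ltn_divLR // mul1n.
      by rewrite /g divn_small // addn1 ltnS lt0n addn_eq0 !E hxy.
    by rewrite mul0n add0n subn0 mul1n kM2.
  split.
    by move=> i hi; rewrite !ltn_eqF //; apply: leq_trans hi _.
  split.
    by move=> a ha; rewrite ltn_eqF ?kM2 //; apply: leq_trans ha _; rewrite leq_addr.
  move=> i; rewrite ltnS leq_eqVlt eqn_add2l => /orP[/eqP ->|lt].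
    by rewrite eqxx rd.
  by rewrite ltn_eqF // I2.
move=> r' M' [k' [kM' hI]]; split=> //.
  move=> i hi; rewrite k' ?(leq_trans hi) // /r1 /upd ltn_eqF //.
move=> q x y; rewrite ltnS leqn0 => /eqP -> hx hy; rewrite mul0n add0n hI; last exact: flat2_lt.
by rewrite divnMDl // (divn_small hy) addn0 modnMDl (modn_small hy).
Qed.

(** The result occupies the cells from 2 d^2 to 3 d^2, starting at the cell that held 0 during
    padding; the source lies above, so the invariant protects everything from 3 d^2 on. *)
Lemma wp_out d D cur (r : rg) (M : mm) F :
  r 0%N = Int d -> r 3%N = Int D -> r 6%N = Int cur -> (0 < d)%N -> (d <= D)%N ->
  (3 * (d * d) <= cur)%N -> (cur + D * D <= V)%N -> stack M cur 1 D F ->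
  wp out_loop (fun r' M' => forall x y, (x < d)%N -> (y < d)%N ->
     M' (2 * (d * d) + (x * d + y))%N = Elt (F 0%N x y)) r M (D * D * 100 + 10).
Proof.
move=> h0 h3 h6 d_gt0 dD hcur hV hF.
have D0 : (0 < D)%N by apply: leq_trans dD.
have DV : (D <= V)%N by nia.
have dV : (d <= V)%N by lia.
have ddDD : (d * d <= D * D)%N by rewrite leq_mul.
have ddV : (d * d <= V)%N by lia.
have cV : (cur <= V)%N by lia.
pose I j (M' : mm) := (forall a, (3 * (d * d) <= a)%N -> M' a = M a) /\
   forall i, (i < j)%N -> M' (2 * (d * d) + i)%N = Elt (F 0%N (i %/ d)%N (i %% d)%N).
rewrite /out_loop; set body := (X in For 20 11 X).
have bc : (cost s l body <= 80)%N by [].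
apply: (@wp_le _ _ _ _ _ _ _ _ (4 + (d * d * (80 + 6) + 4))%N); last by nia.
apply: wp_slseq; do 2! rewrite /upd /= ?(h0, dV).
pose r1 : rg := upd r 11 (Int (d * d)%N).
apply: (@wp_mono _ _ _ _ _ (fun r' M' => keep 20 r1 r' /\ I (d * d)%N M') _ _ _ (d * d * (80 + 6) + 4)%N) => //.
  apply: wp_for => //.
  move=> j r2 M2 jN k2 r2j [kM2 I2]; apply: (@wp_le _ _ _ _ _ _ _ _ (cost s l body)) bc.
  apply: wp_sl.
  have jV : (j <= V)%N by lia.
  have g0 : r2 0%N = Int d by rewrite k2.
  have g3 : r2 3%N = Int D by rewrite k2.
  have g6 : r2 6%N = Int cur by rewrite k2.
  have q1 : (j %/ d <= V)%N by apply: leq_trans (leq_div _ _) jV.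
  have q2 : (j %% d <= V)%N by apply: leq_trans (leq_mod _ _) jV.
  rewrite /body.
  do 5! rewrite /upd /= ?(r2j, g0, g3, g6, jV, dV, DV, cV, q1, q2, leq_trunc_div, subn_div_mod, V2).
  have rd : M2 (cur + j %/ d * D + j %% d)%N = Elt (F 0%N (j %/ d)%N (j %% d)%N).
    rewrite -addnA kM2; last by apply: leq_trans hcur (leq_addr _ _).
    have := hF 0%N (j %/ d)%N (j %% d)%N; rewrite mul0n add0n; apply=> //.
      by apply: leq_trans dD; rewrite ltn_divLR.
    by apply: leq_trans dD; rewrite ltn_mod.
  split.
    by move=> i hi; rewrite !ltn_eqF //; apply: leq_trans hi _.
  split.
    by move=> a ha; rewrite gtn_eqF ?kM2 //; lia.
  move=> i; rewrite ltnS leq_eqVlt eqn_add2l => /orP[/eqP ->|lt].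
    by rewrite eqxx rd.
  by rewrite ltn_eqF // I2.
move=> r' M' [k' [kM' hI]] x y hx hy; rewrite hI; last exact: flat2_lt.
by rewrite divnMDl // (divn_small hy) addn0 modnMDl (modn_small hy).
Qed.

End FlatLoops.

(** * The complete algorithm *)

Section Correctness.
Variables (R : nzRingType) (s s0 p0 : nat) (al be ga : nat -> nat -> int).
Hypothesis s_gt0 : (0 < s)%N.
Hypothesis s0_gt0 : (0 < s0)%N.
Hypothesis bilin : forall (X Y : nat -> R) i j, (i < s0)%N -> (j < s0)%N ->
    \sum_(z < s0) X (i * s0 + z)%N * Y (z * s0 + j)%N =
    \sum_(t < p0) (lin (s0 * s0) (al t) X * lin (s0 * s0) (be t) Y) *~ ga (i * s0 + j)%N t.

(** A contraction index below s0 S is a block index together with an inner index z. For each fixed z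
    the bilinear identity applies to the s0 x s0 matrices [X z] and [Y z], and summing over z gives
    the block product. *)
Lemma Dec_mulF_Enc S (F H : nat -> nat -> nat -> R) q x y : (0 < S)%N -> (x < s0 * S)%N -> (y < s0 * S)%N ->
  Dec s0 p0 ga S (mulF S (Enc s0 p0 al S F) (Enc s0 p0 be S H)) q x y =
  mulF (s0 * S) F H q x y.
Proof.
move=> S_gt0 hx hy; have hx1 : (x %/ S < s0)%N by rewrite ltn_divLR.
have hy1 : (y %/ S < s0)%N by rewrite ltn_divLR.
pose X z e := F q (e %/ s0 * S + x %% S)%N (e %% s0 * S + z)%N.
pose Y z e := H q (e %/ s0 * S + z)%N (e %% s0 * S + y %% S)%N.
have EF t z : (t < p0)%N -> Enc s0 p0 al S F (q * p0 + t) (x %% S) z = lin (s0 * s0) (al t) (X z).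
  move=> ht; have p_gt0 : (0 < p0)%N by apply: leq_ltn_trans ht.
  by rewrite /Enc divnMDl // (divn_small ht) addn0 modnMDl (modn_small ht).
have EH t z : (t < p0)%N -> Enc s0 p0 be S H (q * p0 + t) z (y %% S) = lin (s0 * s0) (be t) (Y z).
  move=> ht; have p_gt0 : (0 < p0)%N by apply: leq_ltn_trans ht.
  by rewrite /Enc divnMDl // (divn_small ht) addn0 modnMDl (modn_small ht).
transitivity (\sum_(z < S) \sum_(t < p0)
   (lin (s0 * s0) (al t) (X z) * lin (s0 * s0) (be t) (Y z)) *~ ga (x %/ S * s0 + y %/ S)%N t).
  rewrite exchange_big; apply: eq_bigr => t _ /=; rewrite /mulF mulrz_suml.
  by apply: eq_bigr => z _; rewrite EF // EH.
rewrite /mulF (sum_flat s0 S (fun z => F q x z * H q z y)) [RHS]exchange_big.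
apply: eq_bigr => z _; rewrite -bilin //; apply: eq_bigr => b _.
rewrite /X /Y !divnMDl // !modnMDl (divn_small hy1) (modn_small hy1) !addn0.
by rewrite (divn_small (ltn_ord b)) (modn_small (ltn_ord b)) addn0 -!divn_eq.
Qed.

Lemma decs_encs j (F H : nat -> nat -> nat -> R) q x y : (x < s * s0 ^ j)%N -> (y < s * s0 ^ j)%N ->
  decs s s0 p0 ga j (mulF s (encs s s0 p0 al j F) (encs s s0 p0 be j H)) q x y =
  mulF (s * s0 ^ j) F H q x y.
Proof.
elim: j F H q x y => [|j IH] F H q x y hx hy; first by rewrite expn0 muln1.
have S_gt0 : (0 < s * s0 ^ j)%N by rewrite muln_gt0 s_gt0 expn_gt0 s0_gt0.
have SE : (s * s0 ^ j.+1 = s0 * (s * s0 ^ j))%N by rewrite expnS; ring.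
rewrite SE in hx hy *; rewrite -Dec_mulF_Enc //=.
by apply: eq_bigr => t _; rewrite IH // ltn_mod.
Qed.

End Correctness.

Definition setup_loop (s0 p0 : nat) : cmd :=
  While 3 0 (Seq (Assign 3 (EC s0 * #3)) (Assign 8 (EC p0 * #8))).

(** Immediate operands are integers only, so the ring's 0 is made as x - x from the first entry of
    A. *)
Definition setup_tail : cmd :=
  Seq (Assign 4 (#8 * (#1 * #1))) (Seq (Ld 5 (EC 0)) (Seq (El Defs.Sub 5 5 5)
  (Seq (St (EC 2 * (#0 * #0)) 5) (Assign 6 (EC 3 * (#0 * #0)))))).

Definition encode (s0 p0 : nat) (G : nat -> nat -> int) (src : expr) (k : nat) : cmd :=
  Seq (pad_loop src) (Seq (Seq (Assign 7 (#3)) (Assign 8 (EC 1)))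
  (Seq (enc_loop s0 p0 G) (Seq (Assign k (#6)) (Assign 6 (#6 + #4))))).

Definition strassen_cmd (s0 p0 : nat) (al be ga : nat -> nat -> int) : cmd :=
  Seq (Seq (Assign 3 (#1)) (Assign 8 (EC 1))) (Seq (setup_loop s0 p0) (Seq setup_tail
  (Seq (encode s0 p0 al (EC 0) 9) (Seq (encode s0 p0 be (#0 * #0) 10)
  (Seq prod_loop (Seq (dec_loop s0 p0 ga) out_loop)))))).

Lemma strassen_cmd_wf s0 p0 al be ga : cwf (strassen_cmd s0 p0 al be ga).
Proof.
have he G := cwf_pass_enc s0 p0 G; have hd := cwf_pass_dec s0 p0 ga.
by rewrite /strassen_cmd /encode /enc_loop /dec_loop /enc_step /dec_step /For /=
   -/(cwf (pass_enc s0 p0 al)) ?he ?hd; move: (he al) (he be) hd => /= -> -> ->.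
Qed.

Section Main.
Variables (R : nzRingType) (s l V s0 p0 : nat).
Hypothesis s0_gt1 : (1 < s0)%N.
Hypothesis p0_gt : (s0 * s0 < p0)%N.
Hypothesis p0V : (p0 <= V)%N.
Hypothesis s_gt0 : (0 < s)%N.
Notation rg := (nat -> word R).
Notation mm := (nat -> word R).
Local Notation ev := (@ev R V).
Local Notation wp := (@wp R s l V).

Let V4 : (4 <= V)%N. Proof. by move: s0_gt1 p0_gt p0V; clear; nia. Qed.
Let V2 : (2 <= V)%N. Proof. exact: leq_trans V4. Qed.
Let s0V : (s0 <= V)%N. Proof. by move: s0_gt1 p0_gt p0V; clear; nia. Qed.
Let s0_gt0 : (0 < s0)%N. Proof. exact: ltnW. Qed.
Let p0_gt0 : (0 < p0)%N. Proof. exact: leq_ltn_trans p0_gt. Qed.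

Lemma wp_setup_loop d j i (r : rg) (M : mm) :
  r 0%N = Int d -> r 3%N = Int (s * s0 ^ i)%N -> r 8%N = Int (p0 ^ i)%N -> (d <= V)%N ->
  (p0 ^ (i + j) <= V)%N ->
  (forall i', (i' < i + j)%N -> (s * s0 ^ i' < d)%N) -> (d <= s * s0 ^ (i + j))%N ->
  wp (setup_loop s0 p0) (fun r' M' => [/\ M' = M,
      forall n, n != 3%N -> n != 8%N -> r' n = r n,
      r' 3%N = Int (s * s0 ^ (i + j))%N & r' 8%N = Int (p0 ^ (i + j))%N]) r M (j * 10 + 2).
Proof.
elim: j i r => [|j IH] i r h0 h3 h8 dV hV lt ge.
  by apply: (@wp_whileF _ _ _ _ _ _ _ _ _ _ _ _ h3 h0); rewrite addn0 in ge *.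
have lti : (s * s0 ^ i < d)%N by apply: lt; rewrite addnS ltnS leq_addr.
have sV : (s * s0 ^ i <= V)%N by apply: leq_trans dV; apply: ltnW.
have pV : (p0 ^ i <= V)%N by apply: leq_trans hV; rewrite leq_pexp2l // leq_addr.
apply: (@wp_le _ _ _ _ _ _ _ _ (8 + (j * 10 + 2) + 2)%N); last by lia.
apply: (wp_whileT h3 h0 lti); apply: wp_sl.
do 3! rewrite /upd /= ?(h3, h8, s0V, p0V, sV, pV).
apply: wp_mono (leqnn _).
  apply: (IH i.+1); rewrite ?addSnnS //=; first by rewrite expnS; congr Int; ring.
  by rewrite expnS.
move=> r' M' [-> hr e3 e8]; rewrite addSnnS in e3 e8; split=> // n n3 n8.
by rewrite hr // (negPf n3) (negPf n8).
Qed.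

(** The clause on registers 9 and 10 preserves the address of the encoded A while B is encoded. *)
Lemma wp_encode G src sa d k Nm cur (kk : nat) (A : nat -> nat -> R) (r : rg) (M : mm) :
  let D := (s * s0 ^ k)%N in
  (forall r' : rg, r' 0%N = Int d -> ev r' src = Some sa) -> (ecost src <= 3)%N ->
  (kk == 9%N) || (kk == 10%N) ->
  r 0%N = Int d -> r 1%N = Int s -> r 3%N = Int D -> r 4%N = Int Nm -> r 5%N = Elt 0 ->
  r 6%N = Int cur -> (0 < d)%N -> (d <= D)%N ->
  Nm = (p0 ^ k * (s * s))%N ->
  (sa + d * d <= cur)%N -> (2 * (d * d) < cur)%N -> (cur + k.+1 * Nm <= V)%N ->
  (forall x y, (x < d)%N -> (y < d)%N -> M (sa + (x * d + y))%N = Elt (A x y)) ->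
  M (2 * (d * d))%N = Elt 0 ->
  wp (encode s0 p0 G src kk) (fun r' M' =>
    [/\ keep 6 r r', r' 7%N = Int s, r' 8%N = Int (p0 ^ k)%N &
        forall i, (8 < i < 11)%N -> i != kk -> r' i = r i] /\
    [/\ r' kk = Int (cur + k * Nm)%N, r' 6%N = Int (cur + k.+1 * Nm)%N,
        keep cur M M' &
        stack M' (cur + k * Nm) (p0 ^ k) s (encs s s0 p0 G k
         (fun _ x y => if (x < d)%N && (y < d)%N then A x y else 0))]) r M
   (Nm * (enc_const s0 p0 G + 100) + 30).
Proof.
move=> D hsrc csrc hkk h0 h1 h3 h4 h5 h6 d_gt0 dD NmE hsa h2d hV hA hz.
have hDN : (D * D <= Nm)%N by rewrite /D sqS NmE leq_mul2r pow_le ?orbT.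
have D_gt0 : (0 < D)%N by apply: leq_trans dD.
have hcV : (cur + k * Nm + Nm <= V)%N by rewrite -addnA -mulSnr.
have NmV : (Nm <= V)%N by lia.
have DV : (D <= V)%N by apply: leq_trans NmV; apply: leq_trans hDN; rewrite leq_pmulr.
apply: (@wp_le _ _ _ _ _ _ _ _ ((D * D * 100 + 10) + (4 + ((enc_const s0 p0 G *
   (1 * (s * s) * (p0 ^ k - (s0 * s0) ^ k)) + 2) + 6)))%N); last first.
  have h : (1 * (s * s) * (p0 ^ k - (s0 * s0) ^ k) <= Nm)%N.
    by rewrite mul1n NmE mulnC leq_mul2r leq_subr orbT.
  have := leq_mul (leqnn (enc_const s0 p0 G)) h.
  move: (enc_const s0 p0 G * _)%N => C; nia.
apply: wp_seq; apply: wp_mono (leqnn _).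
  apply: (wp_pad _ _ V2 hsrc csrc h0 h3 h6 d_gt0 dD hsa h2d _ hA hz).
  by apply: leq_trans hcV; rewrite -addnA leq_add2l; lia.
move=> r1 M1 [k1 kM1 st1]; apply: wp_slseq.
have g1 : r1 1%N = Int s by rewrite k1.
have g3 : r1 3%N = Int D by rewrite k1.
have g4 : r1 4%N = Int Nm by rewrite k1.
have g5 : r1 5%N = Elt 0 by rewrite k1.
have g6 : r1 6%N = Int cur by rewrite k1.
do 2! rewrite /upd /= ?(g3, DV, (ltnW V2)).
apply: wp_seq; apply: wp_mono (leqnn _).
  by apply: (wp_enc_loop l V2 s0_gt1 p0_gt s0V p0V s_gt0 G (j := k) (cur := cur) (Nm := Nm) (Q := 1)
    (F := fun _ x y => if (x < d)%N && (y < d)%N then A x y else 0)) => //;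
    rewrite ?mul1n ?NmE.
move=> r2 M2 [[k2 e9 e10] [e6 e7 e8 kM2 st2]]; apply: wp_sl.
have f4 : r2 4%N = Int Nm by rewrite k2.
have cV : (cur + k * Nm <= V)%N by lia.
rewrite mul1n in e8 st2.
rewrite /= in e9 e10.
case/orP: hkk => /eqP ->; do 3! rewrite /upd /= ?(e6, f4, cV, NmV).
  split; split=> //.
  - move=> i hi; rewrite !ltn_eqF ?(leq_trans hi) // k2 // !ltn_eqF ?(leq_trans hi) // k1 //.
    exact: leq_trans hi _.
  - by move=> i /andP[i1 i2] i9; case: i i1 i2 i9 => [|[|[|[|[|[|[|[|[|[|[|i]]]]]]]]]]] //= *; rewrite e10 k1.
  - by rewrite mulSnr addnA.
  - by apply: keep_trans kM1 _; apply: keepW kM2; rewrite leq_addr.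
split; split=> //.
- move=> i hi; rewrite !ltn_eqF ?(leq_trans hi) // k2 // !ltn_eqF ?(leq_trans hi) // k1 //.
  exact: leq_trans hi _.
- by move=> i /andP[i1 i2] i9; case: i i1 i2 i9 => [|[|[|[|[|[|[|[|[|[|[|i]]]]]]]]]]] //= *; rewrite e9 k1.
- by rewrite mulSnr addnA.
- by apply: keep_trans kM1 _; apply: keepW kM2; rewrite leq_addr.
Qed.

Lemma init_mem_A d (A B : 'M[R]_d) (x y : 'I_d) :
  Defs.mem (init s A B) (0 + (x * d + y))%N = Elt (A x y).
Proof.
rewrite /init /= store_mx_out; last first.
  by rewrite expnS expn1 (flat2_lt (ltn_ord x) (ltn_ord y)).
by rewrite addnA store_mx_in.
Qed.

Lemma init_mem_B d (A B : 'M[R]_d) (x y : 'I_d) :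
  Defs.mem (init s A B) (d * d + (x * d + y))%N = Elt (B x y).
Proof. by rewrite /init /= addnA expnS expn1 store_mx_in. Qed.

Definition mxfun d (A : 'M[R]_d) (x y : nat) : R :=
  if insub x is Some i then if insub y is Some j then A i j else 0 else 0.

Lemma mxfunE d (A : 'M[R]_d) (x y : 'I_d) : mxfun A x y = A x y.
Proof. by rewrite /mxfun !valK. Qed.

Lemma mulF_pad d D (A B : 'M[R]_d) (x y : 'I_d) : (d <= D)%N ->
  mulF D (fun _ x y => if (x < d)%N && (y < d)%N then mxfun A x y else 0)
         (fun _ x y => if (x < d)%N && (y < d)%N then mxfun B x y else 0) 0 x y =
  (A *m B) x y.
Proof.
move=> dD; rewrite /mulF mxE.
transitivity (\sum_(z < d) mxfun A x z * mxfun B z y).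
  rewrite (big_ord_widen_cond _ xpredT (fun z => mxfun A x z * mxfun B z y) dD).
  rewrite [RHS]big_mkcond; apply: eq_bigr => z _ /=; rewrite !ltn_ord andbT /=.
  by case: ifP; rewrite ?mul0r.
by apply: eq_bigr => z _; rewrite !mxfunE.
Qed.

(** The memory bound counts 3 d^2 cells for inputs and output, then k + 1 slots for each of A, B and
    the products with their decodings. *)
Lemma wp_strassen d k (al be ga : nat -> nat -> int) (A B : 'M[R]_d) :
  (forall (X Y : nat -> R) i j, (i < s0)%N -> (j < s0)%N ->
    \sum_(z < s0) X (i * s0 + z)%N * Y (z * s0 + j)%N =
    \sum_(t < p0) (lin (s0 * s0) (al t) X * lin (s0 * s0) (be t) Y) *~ ga (i * s0 + j)%N t) ->
  (s <= d)%N -> (forall i, (i < k)%N -> (s * s0 ^ i < d)%N) -> (d <= s * s0 ^ k)%N ->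
  (3 * (d * d) + 3 * (k.+1 * (p0 ^ k * (s * s))) <= V)%N ->
  wp (strassen_cmd s0 p0 al be ga) (fun r' M' => forall x y : 'I_d,
       M' (2 * (d * d) + (x * d + y))%N = Elt ((A *m B) x y))
     (regs (init s A B)) (Defs.mem (init s A B))
     ((enc_const s0 p0 al + enc_const s0 p0 be + dec_const s0 p0 ga + 1000) *
      (p0 ^ k * (s * s + l))).
Proof.
move=> bilin sd lt ge hV.
set Nm := (p0 ^ k * (s * s))%N; set D := (s * s0 ^ k)%N.
rewrite -/Nm in hV; rewrite -/D in ge.
have d_gt0 : (0 < d)%N by apply: leq_trans sd.
have dd_gt0 : (0 < d * d)%N by rewrite muln_gt0 d_gt0.
have m_gt0 : (0 < s * s)%N by rewrite muln_gt0 s_gt0.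
have pk_gt0 : (0 < p0 ^ k)%N by rewrite expn_gt0 p0_gt0.
have hDN : (D * D <= Nm)%N by rewrite /D sqS leq_mul2r pow_le ?orbT.
have NmV : (Nm <= V)%N by move: hV; rewrite mulSn; lia.
have dV : (d <= V)%N by have : (d <= d * d)%N by [rewrite leq_pmulr]; lia.
have sV : (s <= V)%N by apply: leq_trans dV.
have pkV : (p0 ^ k <= V)%N by apply: leq_trans NmV; rewrite leq_pmulr.
(* The k rounds of the setup loop are thereby paid for by the p0^k tensor calls. *)
have k_le : (k <= p0 ^ k)%N.
  by apply: ltnW; apply: ltn_expl; move: s0_gt1 p0_gt; clear; nia.
set L := (p0 ^ k * (s * s + l))%N.
have NL : (Nm <= L)%N by rewrite leq_mul2l leq_addr orbT.
have pL : (p0 ^ k <= L)%N by apply: leq_trans NL; rewrite leq_pmulr.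
(* The summands follow the commands of the program in order; the 1000 in the bound is generous slack
   for all additive constants. *)
apply: (@wp_le _ _ _ _ _ _ _ _ (4 + ((k * 10 + 2) + (21 + ((Nm * (enc_const s0 p0 al + 100) + 30) +
   ((Nm * (enc_const s0 p0 be + 100) + 30) + ((p0 ^ k * (s * s + l + 27) + 4) +
   ((dec_const s0 p0 ga * ((s0 * s0) ^ 0 * (s * s) * (p0 ^ k - (s0 * s0) ^ k)) + 2)
     + (D * D * 100 + 10))))))))%N); last first.
  have h1 : (p0 ^ k * (s * s + l + 27) <= 28 * L)%N.
    by rewrite mulnDr -/L [(28 * L)%N]mulSn leq_add2l mulnC leq_mul2l pL orbT.
  have h2 : ((s0 * s0) ^ 0 * (s * s) * (p0 ^ k - (s0 * s0) ^ k) <= L)%N.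
    apply: leq_trans NL; rewrite expn0 mul1n mulnC leq_mul2r leq_subr orbT //.
  have h3 := leq_mul (leqnn (dec_const s0 p0 ga)) h2.
  have h4 := leq_mul NL (leqnn (enc_const s0 p0 al)).
  have h5 := leq_mul NL (leqnn (enc_const s0 p0 be)).
  have L_gt0 : (0 < L)%N by apply: leq_trans pL.
  move: (enc_const s0 p0 al) (enc_const s0 p0 be) (dec_const s0 p0 ga) h3 h4 h5 => c1 c2 c3.
  move: (_ * (p0 ^ k - _))%N h2 => x h2.
  move: (p0 ^ k * (s * s + l + 27))%N h1 => a1 h1.
  move: (D * D)%N hDN => DD hDN.
  move: (p0 ^ k)%N k_le pL => P k_le pL.
  clear -h1 h2 hDN k_le pL NL L_gt0; move: Nm L NL L_gt0 h1 h2 hDN pL => N L' *; lia.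
set r0 := regs _; set M0 := Defs.mem _.
have e0 : r0 0%N = Int d by [].
have e1 : r0 1%N = Int s by [].
apply: wp_slseq; do 2! rewrite /upd /= ?(sV, ltnW V2).
apply: wp_seq; apply: wp_mono (leqnn _).
  by apply: (@wp_setup_loop d k 0) => //=; rewrite ?expn0 ?muln1.
move=> r1 M1 [-> k1 r13 r18]; rewrite add0n in r13 r18.
have r10 : r1 0%N = Int d by rewrite k1.
have r11 : r1 1%N = Int s by rewrite k1.
have hA (x y : nat) : (x < d)%N -> (y < d)%N -> M0 (0 + (x * d + y))%N = Elt (mxfun A x y).
  by move=> hx hy; have := init_mem_A A B (Ordinal hx) (Ordinal hy); rewrite -mxfunE.
have hB (x y : nat) : (x < d)%N -> (y < d)%N -> M0 (d * d + (x * d + y))%N = Elt (mxfun B x y).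
  by move=> hx hy; have := init_mem_B A B (Ordinal hx) (Ordinal hy); rewrite -mxfunE.
have hA0 : M0 0%N = Elt (mxfun A 0 0) by have := hA 0%N 0%N d_gt0 d_gt0; rewrite mul0n.
apply: wp_slseq.
have V3 : (3 <= V)%N by apply: leq_trans V4.
do 5! rewrite /upd /= ?(r10, r11, r13, r18, sV, pkV, dV, hA0, V2, V3).
rewrite subrr.
set r2 := (X in wp _ _ X _ _); set M2 := (X in wp _ _ _ X _).
have hlt x y : (x < d)%N -> (y < d)%N -> (x * d + y < d * d)%N by exact: flat2_lt.
have hA2 (x y : nat) : (x < d)%N -> (y < d)%N -> M2 (0 + (x * d + y))%N = Elt (mxfun A x y).
  by move=> hx hy; rewrite /M2 ltn_eqF ?hA //; have := hlt x y hx hy; lia.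
have hB2 (x y : nat) : (x < d)%N -> (y < d)%N -> M2 (d * d + (x * d + y))%N = Elt (mxfun B x y).
  by move=> hx hy; rewrite /M2 ltn_eqF ?hB //; have := hlt x y hx hy; lia.
have hz2 : M2 (2 * (d * d))%N = Elt 0 by rewrite /M2 eqxx.
pose c0 := (3 * (d * d))%N; pose K := (k.+1 * Nm)%N.
have hV' : (c0 + 3 * K <= V)%N by [].
have KE : K = (Nm + k * Nm)%N by rewrite /K mulSn.
apply: wp_seq; apply: wp_mono (leqnn _).
  apply: (@wp_encode al (EC 0) 0 d k Nm c0 9 (mxfun A)) hA2 hz2 => //.
  - by rewrite /c0; lia.
  - by rewrite /c0; lia.
  - by rewrite -/K; lia.
move=> r3 M3 [[k3 r37 r38 r3i] [r39 r36 kM3 st3]].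
rewrite -/K in r36.
apply: wp_seq; apply: wp_mono (leqnn _).
  apply: (@wp_encode be (#0 * #0)%xp (d * d) d k Nm (c0 + K) 10 (mxfun B)) => //.
  - by move=> r' hr'; rewrite /= hr' dV.
  - by rewrite k3.
  - by rewrite k3.
  - by rewrite k3 //= -/D r13.
  - by rewrite k3.
  - by rewrite k3.
  - by rewrite /c0; lia.
  - by rewrite /c0; lia.
  - by rewrite -/K; lia.
  - move=> x y hx hy; rewrite kM3 ?hB2 //; have := hlt x y hx hy; rewrite /c0; lia.
  - by rewrite kM3 // /c0; lia.
move=> r4 M4 [[k4 r47 r48 r4i] [r410 r46 kM4 st4]].
rewrite -/K in r46.
have r49 : r4 9%N = Int (c0 + k * Nm)%N by rewrite r4i.
have st3' : stack M4 (c0 + k * Nm) (p0 ^ k) s (encs s s0 p0 al k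
   (fun _ x y => if (x < d)%N && (y < d)%N then mxfun A x y else 0)).
  by apply: stack_keep kM4 st3; rewrite -mulnA -/Nm KE; lia.
have g0 : r4 0%N = Int d by rewrite k4 // k3.
have g1 : r4 1%N = Int s by rewrite k4 // k3.
have g3 : r4 3%N = Int D by rewrite k4 // k3 //= r13.
have g4 : r4 4%N = Int Nm by rewrite k4 // k3.
have g5 : r4 5%N = Elt 0 by rewrite k4 // k3.
apply: wp_seq; apply: wp_mono (leqnn _).
  apply: (wp_prod _ V2 (Nm := Nm) s_gt0 g1 r48 r49 r410 r46 sV (leqnn _) _ _ _ st3' st4).
  - by rewrite KE; lia.
  - by rewrite KE; lia.
  - by move: hV'; rewrite KE; lia.
move=> r5 M5 [k5 kM5 st5].
apply: wp_seq; apply: wp_mono (leqnn _).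
  apply: (@wp_dec_loop _ _ l _ _ _ V2 s0_gt1 p0_gt s0V p0V s_gt0 ga 0 k _ _ (c0 + K + K) Nm
     (mulF s (encs s s0 p0 al k
         (fun _ x y => if (x < d)%N && (y < d)%N then mxfun A x y else 0))
       (encs s s0 p0 be k
         (fun _ x y => if (x < d)%N && (y < d)%N then mxfun B x y else 0)))); rewrite ?k5 ?add0n ?expn0 ?muln1 //.
  by rewrite -/K; lia.
move=> r6 M6 [k6 r66 kM6 st6]; rewrite add0n -/D in st6.
apply: wp_mono (leqnn _).
  apply: (wp_out _ _ V2 (d := d) (D := D) _ _ r66 d_gt0 ge _ _ st6).
  - by rewrite k6 // k5.
  - by rewrite k6 // k5.
  - by rewrite -/c0; lia.
  - by move: hV'; rewrite KE; lia.
move=> r7 M7 h7 x y; rewrite h7 //; congr Elt.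
have hxD : (x < D)%N by apply: leq_trans ge.
have hyD : (y < D)%N by apply: leq_trans ge.
by rewrite (decs_encs s_gt0 s0_gt0 bilin) // mulF_pad.
Qed.

End Main.

(** * Word size, exponent and the final estimate *)

Lemma pred_pow_le s s0 p0 d k : (0 < s)%N -> (1 < s0)%N ->
  (forall i, (i < k)%N -> (s * s0 ^ i < d)%N) -> (0 < d)%N ->
  (k <= d)%N /\ (p0 ^ k <= p0 * d ^ p0 + 1)%N.
Proof.
move=> s_gt0 s0_gt1 lt d_gt0; case: k lt => [|k] lt.
  by rewrite leq_addl.
(* Minimality of the depth: 2^(k-1) <= s s0^(k-1) < d. With p0 <= 2^p0 this makes p0^k polynomial in
   d, with an exponent that is crude but independent of n; the + 1 in the bound covers k = 0. *)
have hk : (2 ^ k <= d)%N.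
  apply: ltnW; apply: leq_ltn_trans (lt k (leqnn _)).
  apply: (@leq_trans (s0 ^ k)%N); last by rewrite leq_pmull.
  by case: (k) => // j; rewrite leq_exp2r.
split; first by apply: leq_trans hk; apply: ltn_expl.
rewrite expnS; apply: (@leq_trans (p0 * d ^ p0)%N); last by rewrite leq_addr.
rewrite leq_mul2l; apply/orP; right.
apply: (@leq_trans ((2 ^ p0) ^ k)%N).
  by case: (k) => // j; rewrite leq_exp2r // ltnW // ltn_expl.
rewrite -expnM mulnC expnM.
by case: (p0) => // j; rewrite leq_exp2r.
Qed.

(** With z a power of 2 that is at least 2n, each of d^2, s^2 and k + 1 is at most z and p0^k is at
    most z^(2 p0 + 1). The sum is then at most z^(2 p0 + 5); the 64 comes from [fits], and the
    successor makes the inequality strict. *)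
Lemma address_bound_fits s s0 p0 d k kappa n : (0 < s)%N -> (1 < s0)%N -> (1 < n)%N ->
  (s <= d)%N -> n = (d ^ 2)%N ->
  (forall i, (i < k)%N -> (s * s0 ^ i < d)%N) ->
  ((64 * (2 * p0 + 5)).+1 * up_log 2 (2 * n) <= kappa)%N ->
  fits (3 * (d * d) + 3 * (k.+1 * (p0 ^ k * (s * s))) + p0) kappa.
Proof.
move=> s_gt0 s0_gt1 n1 sd nE lt hk.
have d_gt0 : (0 < d)%N by apply: leq_trans sd.
have [kd pk] := @pred_pow_le s s0 p0 d k s_gt0 s0_gt1 lt d_gt0.
have := @up_logP 2 (2 * n) isT; move: hk; move: (up_log 2 _) => U hk hU.
move zE : (2 ^ U)%N hU => z hU.
have z4 : (4 <= z)%N by apply: leq_trans hU; lia.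
have nd : n = (d * d)%N by rewrite nE expnS expn1.
have ddz : (d * d <= z)%N by lia.
have ssz : (s * s <= z)%N by apply: leq_trans ddz; rewrite leq_mul.
have dz : (d <= z)%N by nia.
have kz : (k.+1 <= z)%N by nia.
have z_gt0 : (0 < z)%N by lia.
have pz : (p0 <= z ^ p0)%N.
  by apply: leq_trans (ltnW (ltn_expl _ (isT : 1 < 2)%N)) _; case: (p0) => // j; rewrite leq_exp2r //; lia.
have dpz : (d ^ p0 <= z ^ p0)%N by case: (p0) => // j; rewrite leq_exp2r.
have pkz : (p0 ^ k <= z ^ (2 * p0 + 1))%N.
  apply: leq_trans pk _; rewrite expnD expn1 mul2n -addnn expnD.
  have h := leq_mul pz dpz.
  have : (1 <= z ^ p0 * z ^ p0)%N by rewrite muln_gt0 !expn_gt0 z_gt0.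
  move: (z ^ p0 * z ^ p0)%N h => A h A1; apply: leq_trans (leq_add h A1) _.
  by rewrite addnn -muln2 leq_mul2l; apply/orP; right; lia.
have V_le : (3 * (d * d) + 3 * (k.+1 * (p0 ^ k * (s * s))) + p0 <= z ^ (2 * p0 + 5))%N.
  have E : (z ^ (2 * p0 + 5) = z * (z * (z * (z * z ^ (2 * p0 + 1)))))%N.
    by rewrite !addnS !expnS.
  have h := leq_mul kz (leq_mul pkz ssz).
  have pz' : (p0 <= z ^ (2 * p0 + 1))%N.
    by apply: leq_trans pz _; rewrite leq_exp2l; lia.
  have A1 : (1 <= z ^ (2 * p0 + 1))%N by rewrite expn_gt0 z_gt0.
  rewrite {}E; move: (k.+1 * _)%N h => B h; move: (z ^ _)%N A1 h pz' => A A1 h pz'.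
  have hX : (z * (z * A) = z * (A * z))%N by ring.
  have zA : (z <= z * (z * A))%N by rewrite leq_pmulr // muln_gt0 z_gt0.
  have AA : (A <= z * (z * A))%N by rewrite mulnA leq_pmull // muln_gt0 z_gt0.
  (* Each of the 3 + 3 + 1 terms is at most X = z^2 A, and 7 X <= 16 X <= z^2 X because z >= 4. *)
  rewrite -hX in h; move: (z * (z * A))%N h zA AA => X h zA AA.
  apply: (@leq_trans (4 * (4 * X))%N); first by clear -ddz h zA AA pz'; lia.
  by rewrite !leq_mul.
rewrite /fits.
apply: leq_ltn_trans (_ : (z ^ (2 * p0 + 5)) ^ 64 < _)%N; first by rewrite leq_exp2r.
rewrite -zE -!expnM ltn_exp2l //.
have U_gt0 : (0 < U)%N by case: (U) zE z4 => // <-.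
by apply: leq_trans hk; clear -U_gt0; lia.
Qed.

Lemma powR_log_exp (K : realType) (n0 p0 k : nat) : (1 < n0)%N -> (0 < p0)%N ->
  ((n0 ^ k)%N%:R : K) `^ (ln p0%:R / ln n0%:R) = (p0 ^ k)%N%:R.
Proof.
move=> n1 p0_gt0.
have n0_gt0 : (0 < n0%:R :> K) by rewrite ltr0n ltnW.
have base : (n0%:R : K) `^ (ln p0%:R / ln n0%:R) = p0%:R.
  rewrite /powR gt_eqF // divfK ?lnK ?posrE ?ltr0n //.
  by rewrite gt_eqF // ln_gt0 // ltr1n.
by rewrite !natrX -powR_mulrn ?ler0n // powRAC base powR_mulrn // ler0n.
Qed.

Theorem theorem1 (K : realType) (R : nzRingType) (n0 s0 p0 c : nat)
    (base : slp s0) (hn0 : n0 = (s0 ^ 2)%N) (n0_gt1 : (1 < n0)%N)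
    (hbase : strassen_like R p0 c base) :
  let omega0 : K := ln p0%:R / ln n0%:R in
  exists (P : program) (C : K) (w : nat),
    forall m s l n d kappa : nat,
      m = (s ^ 2)%N -> n = (d ^ 2)%N ->
      (n0 <= m)%N -> (m <= n)%N ->
      (w * up_log 2 (2 * n) <= kappa)%N ->
      forall A B : 'M[R]_d,
        exists t : nat,
          computes_product kappa s l P A B t /\
          t%:R <= C * ((n%:R / m%:R) `^ omega0 * (m%:R + l%:R)).
Proof.
move=> omega0; have [_ hmuls _ _ hcorr] := hbase.
have s0_gt1 : (1 < s0)%N by move: n0_gt1; rewrite hn0; case: (s0) => [|[|]].
have [al [be [ga]]] := slp_bilinear (hcorr 3); rewrite hmuls => bilin.
have p0_gt := bilinear_rank s0_gt1 bilin.
have p0_gt0 : (0 < p0)%N by apply: leq_ltn_trans p0_gt.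
pose cmd0 := strassen_cmd s0 p0 al be ga.
pose C0 := (enc_const s0 p0 al + enc_const s0 p0 be + dec_const s0 p0 ga + 1000)%N.
(* The factor p0 pays for rounding the depth k up to an integer, and the last witness is the
   word-size factor of [address_bound_fits]. *)
exists (compile 0 cmd0), (C0%:R * p0%:R), (64 * (2 * p0 + 5)).+1.
move=> m s l n d kappa mE nE n0m mn hkappa A B.
have s0s : (s0 <= s)%N by move: n0m; rewrite hn0 mE leq_exp2r.
have sd : (s <= d)%N by move: mn; rewrite mE nE leq_exp2r.
have s_gt0 : (0 < s)%N by apply: leq_trans s0s; apply: ltnW.
have exk : exists k, (d <= s * s0 ^ k)%N.
  exists d; apply: (@leq_trans (s0 ^ d)%N); last by rewrite leq_pmull.
  exact/ltnW/ltn_expl.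
have := ex_minnP exk => -[k ge kmin].
have lt i : (i < k)%N -> (s * s0 ^ i < d)%N.
  by move=> ik; rewrite ltnNge; apply/negP => /kmin; rewrite leqNgt ik.
(* The highest address used, with p0 added so that the constants in the program are covered by V as
   well. *)
set V := (3 * (d * d) + 3 * (k.+1 * (p0 ^ k * (s * s))) + p0)%N.
have V2 : (2 <= V)%N by apply: (@leq_trans p0); [nia|rewrite leq_addl].
have n1 : (1 < n)%N by apply: leq_trans mn; apply: leq_trans n0m.
have hfit : fits V kappa by apply: (address_bound_fits s_gt0 s0_gt1 n1 sd nE lt hkappa).
have p0V : (p0 <= V)%N by rewrite leq_addl.
have addrV : (3 * (d * d) + 3 * (k.+1 * (p0 ^ k * (s * s))) <= V)%N by rewrite leq_addr.
have [t [r' [M' [hbs tle hM']]]] :=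
  wp_strassen l s0_gt1 p0_gt p0V s_gt0 A B bilin sd lt ge addrV.
have hat : code_at (compile 0 cmd0) 0 (compile 0 cmd0).
  by exists [::], [::]; rewrite cats0.
have [rc' _ hex] := compile_exec V2 hfit hbs (strassen_cmd_wf s0 p0 al be ga) hat
   (fun _ _ => erefl).
exists t; split.
  exists (State (clen cmd0) rc' M'); split.
    rewrite -[t]addn0; apply: hex; apply: exec_halt.
    by rewrite nth_default // size_compile.
  by move=> i j /=; rewrite -hM' expnS expn1 addnA.
have mR : (0 < m%:R :> K) by rewrite ltr0n; apply: leq_trans n0m; apply: ltnW.
have om0 : 0 <= omega0.
  by rewrite /omega0 divr_ge0 // ln_ge0 // ler1n // ltnW.
(* For k > 0, minimality gives n0^(k-1) <= n / m, and raising to omega0 turns n0^(k-1) into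
   p0^(k-1). For k = 0 it suffices that n / m >= 1. *)
have pk : (p0 ^ k)%N%:R <= p0%:R * (n%:R / m%:R) `^ omega0 :> K.
  have [k0|k_gt0] := posnP k.
    rewrite k0 expn0 -[1%:R]mulr1 ler_pM ?ler01 ?ler1n //.
    apply: le_trans (_ : (1 : K) `^ omega0 <= _); first by rewrite powR1.
    apply: ge0_ler_powR => //; rewrite ?nnegrE ?divr_ge0 ?ler0n //.
    by rewrite ler_pdivlMr // mul1r ler_nat.
  rewrite -(prednK k_gt0) expnS natrM ler_wpM2l ?ler0n //.
  rewrite -(powR_log_exp K k.-1 n0_gt1 p0_gt0).
  apply: ge0_ler_powR => //; rewrite ?nnegrE ?divr_ge0 ?ler0n //.
  rewrite ler_pdivlMr // -natrM ler_nat mE nE hn0.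
  rewrite (_ : _ * _ = (s * s0 ^ k.-1) ^ 2)%N; last first.
    by rewrite expnMn -!expnM [(2 * _)%N]mulnC mulnC.
  by rewrite leq_exp2r // ltnW // lt // prednK.
have -> : C0%:R * p0%:R * ((n%:R / m%:R) `^ omega0 * (m%:R + l%:R)) =
  C0%:R * (p0%:R * (n%:R / m%:R) `^ omega0 * (m%:R + l%:R)) :> K by rewrite !mulrA.
apply: (@le_trans _ _ (C0 * (p0 ^ k * (s * s + l)))%N%:R); first by rewrite ler_nat.
rewrite !natrM ler_wpM2l ?ler0n //.
have -> : (s * s + l)%N%:R = m%:R + l%:R :> K by rewrite natrD mE expnS expn1.
by rewrite ler_wpM2r // addr_ge0 // ler0n.
Qed.
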